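(* Let $\nu>0$ be real with $\nu\notin\mathbb{Z}$, and let $z\in\mathbb{C}$, $z\neq 0$, $|\arg z|<\pi$. Then $$\frac{\partial J_\nu(z)}{\partial\nu}=-\frac{\pi J_{-\nu}(z)\csc(\pi\nu)}{2\,\Gamma^2(\nu+1)}\left(\frac z2\right)^{2\nu}{}_2F_3\left(\left.\begin{array}{c}\nu,\ \nu+\frac12\\ \nu+1,\ \nu+1,\ 2\nu+1\end{array}\right|-z^2\right)-J_\nu(z)\left[\frac{z^2}{4(1-\nu^2)}\,{}_3F_4\left(\left.\begin{array}{c}1,\ 1,\ \frac32\\ 2,\ 2,\ 2-\nu,\ 2+\nu\end{array}\right|-z^2\right)+\log\left(\frac2z\right)+\frac1{2\nu}+\psi(\nu)\right].$$
   Context: Powers and logarithms take their principal values. $J_\nu(z)=(z/2)^\nu\sum_{k\ge0}\frac{(-1)^k(z/2)^{2k}}{k!\,\Gamma(\nu+k+1)}$ is the Bessel function of the first kind; $\partial/\partial\nu$ is the derivative with respect to the order at fixed $z$. $\psi=\Gamma'/\Gamma$ is the digamma function. The generalized hypergeometric function is ${}_pF_q\left(\left.\begin{array}{c}a_1,\dots,a_p\\ b_1,\dots,b_q\end{array}\right|x\right)=\sum_{k\ge0}\frac{(a_1)_k\cdots(a_p)_k}{(b_1)_k\cdots(b_q)_k}\frac{x^k}{k!}$ with $(\alpha)_k=\Gamma(\alpha+k)/\Gamma(\alpha)$ (i.e. $(\alpha)_k=\alpha(\alpha+1)\cdots(\alpha+k-1)$). *)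

(* Defs.v *)
From Stdlib Require Import Reals List Factorial.
From Coquelicot Require Import Coquelicot.
Import ListNotations.

Local Open Scope C_scope.

Definition Cexp (w : C) : C :=
  RtoC (exp (Re w)) * (cos (Im w), sin (Im w)).

(** Principal argument, with values in (-PI, PI] for [z <> 0]. *)
Definition Carg (z : C) : R :=
  if Rle_dec 0 (Im z) then acos (Re z / Cmod z)
  else (- acos (Re z / Cmod z))%R.

Definition Clog (z : C) : C := (ln (Cmod z), Carg z).

(** Principal value of [z ^ w], for [z <> 0]; [Cpow] (written [^]) is the power
    with exponent in [nat]. *)
Definition Cpower (z w : C) : C := Cexp (w * Clog z).

(** Sum of a complex series, taken on real and imaginary parts since [Series]
    is only available for real terms. *)
Definition CSeries (a : nat -> C) : C :=
  (Series (fun k => Re (a k)), Series (fun k => Im (a k))).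

(** Gamma function on the real line by Gauss's limit
      [Gamma x = lim n! n^x / (x (x+1) ... (x+n))],
    valid for every real [x] other than 0, -1, -2, ...  At these poles the
    terms are eventually [_ / 0 = 0], so [Gamma x = 0] and [/ Gamma x = 0],
    which is the usual value of the reciprocal. *)
Definition Gamma (x : R) : R :=
  real (Lim_seq (fun n =>
    (INR (fact n) * Rpower (INR n) x / prod_f_R0 (fun j => x + INR j) n)%R)).

Definition digamma (x : R) : R := (Derive Gamma x / Gamma x)%R.

Definition BesselJ (nu : R) (z : C) : C :=
  Cpower (z / 2) nu *
  CSeries (fun k =>
    RtoC ((-1) ^ k / (INR (fact k) * Gamma (nu + INR k + 1)))%R
    * (z / 2) ^ (2 * k)).

Fixpoint pochhammer (a : C) (k : nat) : C :=
  match k with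
  | O => 1
  | S j => pochhammer a j * (a + INR j)
  end.

Definition pochhammer_prod (l : list C) (k : nat) : C :=
  fold_right Cmult (RtoC 1) (map (fun a => pochhammer a k) l).

(** Generalized hypergeometric series pFq, with [p = length a] upper and
    [q = length b] lower parameters. *)
Definition hypergeom (a b : list C) (x : C) : C :=
  CSeries (fun k =>
    pochhammer_prod a k / pochhammer_prod b k * (x ^ k / INR (fact k))).

(* Main.v *)
Require Import Defs.
From Stdlib Require Import Reals List Factorial Lra Lia FunctionalExtensionality.
From Coquelicot Require Import Coquelicot.
Import ListNotations.

(** Put [x = -(z/2)^2], [A = _0F_1(nu+1; x)], [B = _0F_1(1-nu; x)] and
    [theta = x d/dx].  Differentiating the series of [J_nu] in the order reduces
    the theorem, after the reflection formula for [Gamma], to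
      [sum_k a_k (1 + 2 nu h_k) x^k = B f - 2 nu A g],
    where [a_k] are the coefficients of [A], [h_k = sum_(j<=k) 1/(nu+j)],
    [f = _2F_3(4x)] and [g = x/(1-nu^2) _3F_4(4x)].  Both sides solve
      [(theta^2 + nu theta - x) S = 2 nu theta A] with [S(0) = 1],
    and such a power series is unique.  For the right-hand side this is variation
    of parameters: [(theta + nu) f = nu A^2], [2 theta g = A B - 1], and the
    Wronskian identity [A theta B - B theta A = nu (A B - 1)]; the first two
    relations hold because [A^2] and [A B] satisfy third-order equations, which
    are two-term recurrences for their coefficients. *)

Local Open Scope R_scope.

(** * Formal power series *)

(** With [x = -(z/2)^2], [J_nu(z) = (z/2)^nu A(x) / Gamma(nu+1)], and the hypergeometric argument
    [-z^2] is [4x]. The homogeneous equation [(theta^2 + nu theta - x) y = 0] has the solutions [A]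
    and [x^(-nu) B], which are [J_nu] and [J_(-nu)] divided by [(z/2)^nu], up to constants. The
    coefficient varied in front of [x^(-nu) B] is [x^nu f]: the powers cancel, everything stays
    among power series, and [theta] acting on [x^nu f] becomes [theta + nu] acting on [f]. The
    coefficient of [A] would be an integral of [A B / x], which contains a logarithm; subtracting 1
    from [A B] removes it, and the removed multiple of [A log x] accounts for the shape of the
    right-hand side. On formal series, uniqueness is a recurrence and the identities are [ring]
    computations; convergence enters only when the final identity is evaluated at a complex point.
    [Gamma] is given only as a limit, so its differentiability at positive arguments and its
    reflection formula, where [1 - nu] may be negative, are both derived from Gauss's product. *)

Local Notation fps := (nat -> R) (only parsing).
Definition fps_tail (a : fps) : fps := fun n => a (S n).
Definition fps_const (c : R) : fps := fun n => match n with O => c | _ => 0 end.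
Definition fps_X : fps := fun n => match n with 1%nat => 1 | _ => 0 end.
Definition fps_add (a b : fps) : fps := fun n => a n + b n.
Definition fps_opp (a : fps) : fps := fun n => - a n.
Definition fps_sub (a b : fps) : fps := fun n => a n - b n.
(** The Cauchy product, obtained by peeling off the constant term of the left factor. In this form
    the ring laws are inductions without index subtraction; [fps_mul_sum] recovers the usual finite
    sum. *)
Fixpoint fps_mul (a b : fps) (n : nat) : R :=
  match n with
  | O => a O * b O
  | S m => a O * b (S m) + fps_mul (fps_tail a) b m
  end.
(* The Euler operator [x d/dx]. *)
Definition fps_theta (a : fps) : fps := fun n => INR n * a n.

Lemma fps_mul_addl (a b c : fps) :
  fps_mul (fps_add a b) c = fps_add (fps_mul a c) (fps_mul b c).
Proof.
apply functional_extensionality; intros n; unfold fps_add at 2.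
revert a b; induction n as [|n IH]; intros a b; simpl.
- unfold fps_add; ring.
- change (fps_tail (fps_add a b)) with (fps_add (fps_tail a) (fps_tail b)).
  rewrite IH; unfold fps_add; ring.
Qed.

Lemma fps_mul_0l (a b : fps) (n : nat) :
  (forall k, a k = 0) -> fps_mul a b n = 0.
Proof.
revert a; induction n as [|n IH]; intros a Ha; simpl; rewrite Ha.
- ring.
- rewrite IH; [ring | intros k; apply Ha].
Qed.

Lemma fps_mul_scall (c : R) (a b : fps) (n : nat) :
  fps_mul (fun k => c * a k) b n = c * fps_mul a b n.
Proof.
revert a; induction n as [|n IH]; intros a; simpl.
- ring.
- change (fps_tail (fun k => c * a k)) with (fun k => c * fps_tail a k).
  rewrite IH; ring.
Qed.

Lemma fps_mul_constl (c : R) (b : fps) (n : nat) :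
  fps_mul (fps_const c) b n = c * b n.
Proof.
destruct n as [|n]; simpl; [reflexivity|].
rewrite fps_mul_0l; [ring | reflexivity].
Qed.

Lemma fps_mul_1l (b : fps) : fps_mul (fps_const 1) b = b.
Proof.
apply functional_extensionality; intros n; rewrite fps_mul_constl; ring.
Qed.

Lemma fps_mul_Xl (b : fps) (n : nat) : fps_mul fps_X b (S n) = b n.
Proof.
simpl; replace (fps_tail fps_X) with (fps_const 1).
- rewrite fps_mul_1l; ring.
- apply functional_extensionality; intros [|k]; reflexivity.
Qed.

Lemma fps_mulSr (a b : fps) (n : nat) :
  fps_mul a b (S n) = a (S n) * b O + fps_mul a (fps_tail b) n.
Proof.
revert a; induction n as [|n IH]; intros a.
- simpl; unfold fps_tail; ring.
- change (fps_mul a b (S (S n)))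
    with (a O * b (S (S n)) + fps_mul (fps_tail a) b (S n)).
  rewrite IH; simpl; unfold fps_tail; ring.
Qed.

Lemma fps_mulC (a b : fps) : fps_mul a b = fps_mul b a.
Proof.
apply functional_extensionality; intros n.
revert a b; induction n as [|n IH]; intros a b.
- simpl; ring.
- rewrite fps_mulSr; simpl; rewrite IH; ring.
Qed.

Lemma fps_mulA (a b c : fps) :
  fps_mul a (fps_mul b c) = fps_mul (fps_mul a b) c.
Proof.
apply functional_extensionality; intros n.
revert a; induction n as [|n IH]; intros a.
- simpl; ring.
- change (fps_mul a (fps_mul b c) (S n)) with
    (a O * (b O * c (S n) + fps_mul (fps_tail b) c n)
     + fps_mul (fps_tail a) (fps_mul b c) n).
  change (fps_mul (fps_mul a b) c (S n)) with
    (a O * b O * c (S n) + fps_mul (fps_tail (fps_mul a b)) c n).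
  replace (fps_tail (fps_mul a b)) with
    (fps_add (fun k => a O * fps_tail b k) (fps_mul (fps_tail a) b))
    by reflexivity.
  rewrite fps_mul_addl; unfold fps_add.
  rewrite fps_mul_scall, IH; ring.
Qed.

Lemma fps_ring_theory :
  ring_theory (fps_const 0) (fps_const 1) fps_add fps_mul fps_sub fps_opp eq.
Proof.
split; intros; try (apply functional_extensionality; intros n;
  unfold fps_add, fps_sub, fps_opp, fps_const; try destruct n; ring).
- apply fps_mul_1l.
- apply fps_mulC.
- apply fps_mulA.
- apply fps_mul_addl.
Qed.

Lemma fps_const_morph :
  ring_morph (fps_const 0) (fps_const 1) fps_add fps_mul fps_sub fps_opp eq
    0%Z 1%Z Z.add Z.mul Z.sub Z.opp Z.eqb (fun z => fps_const (IZR z)).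
Proof.
split; try reflexivity; intros.
- apply functional_extensionality; intros [|n]; unfold fps_add; simpl;
    [apply plus_IZR | ring].
- apply functional_extensionality; intros [|n]; unfold fps_sub; simpl;
    [apply minus_IZR | ring].
- apply functional_extensionality; intros n; rewrite fps_mul_constl.
  destruct n; simpl; [apply mult_IZR | ring].
- apply functional_extensionality; intros [|n]; unfold fps_opp; simpl;
    [apply opp_IZR | ring].
- apply Z.eqb_eq in H; now subst.
Qed.

(** Only integer literals count as constants for [ring]; a series such as [nu%:F] with a variable
    [nu] remains an atom. *)
Ltac fps_cst t :=
  match t with
  | fps_const (IZR ?z) => match isZcst z with true => z | _ => InitialRing.NotConstant end
  | _ => InitialRing.NotConstant
  end.

Add Ring fps_ring : fps_ring_theory
  (morphism fps_const_morph, constants [fps_cst]).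


Lemma fps_theta_add (a b : fps) :
  fps_theta (fps_add a b) = fps_add (fps_theta a) (fps_theta b).
Proof.
apply functional_extensionality; intros n; unfold fps_theta, fps_add; ring.
Qed.

Lemma fps_theta_sub (a b : fps) :
  fps_theta (fps_sub a b) = fps_sub (fps_theta a) (fps_theta b).
Proof.
apply functional_extensionality; intros n; unfold fps_theta, fps_sub; ring.
Qed.

Lemma fps_theta_const (c : R) : fps_theta (fps_const c) = fps_const 0.
Proof.
apply functional_extensionality; intros [|n]; unfold fps_theta; simpl; ring.
Qed.

Lemma fps_theta_X : fps_theta fps_X = fps_X.
Proof.
apply functional_extensionality; intros [|[|n]]; unfold fps_theta; simpl; ring.
Qed.

Lemma fps_tail_theta (a : fps) :
  fps_tail (fps_theta a) = fps_add (fps_theta (fps_tail a)) (fps_tail a).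
Proof.
apply functional_extensionality; intros n.
unfold fps_tail, fps_theta, fps_add; rewrite S_INR; ring.
Qed.

Lemma fps_theta_mul (a b : fps) :
  fps_theta (fps_mul a b) =
  fps_add (fps_mul (fps_theta a) b) (fps_mul a (fps_theta b)).
Proof.
apply functional_extensionality; intros n; unfold fps_add.
revert a; induction n as [|n IH]; intros a.
- unfold fps_theta; simpl; ring.
- change (fps_theta (fps_mul a b) (S n)) with
    (INR (S n) * (a O * b (S n) + fps_mul (fps_tail a) b n)).
  change (fps_mul (fps_theta a) b (S n)) with
    (INR 0 * a O * b (S n) + fps_mul (fps_tail (fps_theta a)) b n).
  change (fps_mul a (fps_theta b) (S n)) with
    (a O * (INR (S n) * b (S n)) + fps_mul (fps_tail a) (fps_theta b) n).
  rewrite fps_tail_theta, fps_mul_addl; unfold fps_add.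
  specialize (IH (fps_tail a)); unfold fps_theta at 1 in IH.
  rewrite S_INR; change (INR 0) with 0; lra.
Qed.

Lemma fps_theta_eq0 (a : fps) : fps_theta a = fps_const 0 -> a O = 0 -> a = fps_const 0.
Proof.
intros H H0; apply functional_extensionality; intros [|n]; [exact H0|].
generalize (f_equal (fun f => f (S n)) H); unfold fps_theta; simpl.
intros H1; apply Rmult_integral in H1; destruct H1 as [H1|H1]; [|exact H1].
exfalso; generalize (pos_INR n); change (INR (S n) = 0) in H1; rewrite S_INR in H1; lra.
Qed.

Declare Scope fps_scope.
Delimit Scope fps_scope with fps.
Local Notation "a + b" := (fps_add a b) : fps_scope.
Local Notation "a - b" := (fps_sub a b) : fps_scope.
Local Notation "a * b" := (fps_mul a b) : fps_scope.
Local Notation "c %:F" := (fps_const c) (at level 2, format "c %:F") : fps_scope.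
Local Notation "'theta' a" := (fps_theta a)
  (at level 9, right associativity, a at level 9) : fps_scope.

Lemma fps_sub_eq (a b : fps) : (a - b)%fps = (0%:F)%fps -> a = b.
Proof.
intros H; replace a with ((a - b) + b)%fps by ring; rewrite H; ring.
Qed.

(** In degree [n + 1] the equation reads [(n+1)(n+1+nu) t_(n+1) = t_n], and the factor on the left
    is positive. *)
Lemma fps_bessel_unique (nu : R) (t : fps) :
  0 < nu -> (theta theta t + nu%:F * theta t = fps_X * t)%fps -> t O = 0 -> t = fps_const 0.
Proof.
intros Hnu H H0; apply functional_extensionality; intros n.
replace (fps_const 0 n) with 0 by (destruct n; reflexivity).
induction n as [|n IH]; [exact H0|].
generalize (f_equal (fun u => u (S n)) H).
rewrite fps_mul_Xl, IH; unfold fps_add; rewrite fps_mul_constl; unfold fps_theta.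
intros H1.
assert (Hn : 0 < INR (S n)) by (apply lt_0_INR; lia).
assert (H2 : (INR (S n) * (INR (S n) + nu)) * t (S n) = 0) by (rewrite <- H1; ring).
apply Rmult_integral in H2; destruct H2 as [H2|H2]; [|exact H2].
exfalso; assert (0 < INR (S n) * (INR (S n) + nu)) by (apply Rmult_lt_0_compat; lra).
lra.
Qed.

(** Abel's identity for the solutions [A] and [x^(-nu) B], with the power of [x] cleared. By the two
    equations [theta] kills the difference of the sides, so the difference is constant, and its
    constant term is 0. *)
Lemma fps_bessel_wronskian (nu : R) (A B : fps) :
  (theta theta A = fps_X * A - nu%:F * theta A)%fps -> A O = 1 ->
  (theta theta B = fps_X * B + nu%:F * theta B)%fps -> B O = 1 ->
  (A * theta B = B * theta A + nu%:F * (A * B - 1%:F))%fps.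
Proof.
intros HA HA0 HB HB0; apply fps_sub_eq, fps_theta_eq0.
- rewrite fps_theta_sub, fps_theta_add, !fps_theta_mul, fps_theta_sub,
    !fps_theta_mul, !fps_theta_const, HA, HB; ring.
- unfold fps_sub, fps_add; simpl; unfold fps_theta; simpl; rewrite HA0, HB0; ring.
Qed.

Lemma fps_bessel_identity (nu : R) (A B S f g : fps) :
  0 < nu ->
  (theta theta A = fps_X * A - nu%:F * theta A)%fps -> A O = 1 ->
  (theta theta B = fps_X * B + nu%:F * theta B)%fps -> B O = 1 ->
  (theta theta S = fps_X * S - nu%:F * theta S + 2%:F * nu%:F * theta A)%fps -> S O = 1 ->
  (theta f = nu%:F * (A * A - f))%fps -> f O = 1 ->
  (2%:F * theta g = A * B - 1%:F)%fps -> g O = 0 ->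
  (S = B * f - 2%:F * nu%:F * (A * g))%fps.
Proof.
intros Hnu HA HA0 HB HB0 HS HS0 Hf Hf0 Hg Hg0.
apply fps_sub_eq, (fps_bessel_unique nu); trivial.
- assert (HW := fps_bessel_wronskian nu A B HA HA0 HB HB0).
  assert (HTf : (theta theta f = nu%:F * (2%:F * A * theta A - theta f))%fps).
  { rewrite Hf at 1.
    rewrite fps_theta_mul, fps_theta_sub, fps_theta_const, fps_theta_mul; ring. }
  assert (HTg : (2%:F * theta theta g = A * theta B + B * theta A)%fps).
  { transitivity (theta (2%:F * theta g))%fps.
    - rewrite fps_theta_mul, fps_theta_const; ring.
    - rewrite Hg, fps_theta_sub, fps_theta_mul, fps_theta_const; ring. }
  repeat (rewrite ?fps_theta_sub, ?fps_theta_add, ?fps_theta_mul, ?fps_theta_const).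
  rewrite HA, HB, HS, HTf, Hf.
  apply fps_sub_eq.
  (* The two sides differ by the following combination of the Wronskian
     identity and the defining equations of [g]. *)
  transitivity (
    0%:F - nu%:F * A * (A * theta B - (B * theta A + nu%:F * (A * B - 1%:F)))
    + nu%:F * (2%:F * theta A + nu%:F * A) * (2%:F * theta g - (A * B - 1%:F))
    + nu%:F * A * (2%:F * theta theta g - (A * theta B + B * theta A)))%fps.
  + ring.
  + rewrite Hg, HTg, HW; ring.
- unfold fps_sub, fps_add; simpl; rewrite HS0, HB0, Hf0, Hg0; ring.
Qed.

(** * The hypergeometric identity for formal power series *)

Fixpoint rpoch (a : R) (k : nat) : R :=
  match k with
  | O => 1
  | S j => rpoch a j * (a + INR j)
  end.

Definition rpoch_prod (l : list R) (k : nat) : R :=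
  fold_right Rmult 1 (map (fun a => rpoch a k) l).

Definition shift_prod (l : list R) (k : nat) : R :=
  fold_right Rmult 1 (map (fun a => a + INR k) l).

Definition hyp_coef (a b : list R) (k : nat) : R :=
  rpoch_prod a k / rpoch_prod b k / INR (fact k).

Lemma rpoch_neq0 (a : R) (k : nat) :
  (forall n, a + INR n <> 0) -> rpoch a k <> 0.
Proof.
intros H; induction k as [|k IH]; simpl; [lra|].
now apply Rmult_integral_contrapositive.
Qed.

Lemma rpoch_prod_S (l : list R) (k : nat) :
  rpoch_prod l (S k) = rpoch_prod l k * shift_prod l k.
Proof.
unfold rpoch_prod, shift_prod; induction l as [|a l IH]; simpl in *; [ring|].
rewrite IH; ring.
Qed.

Lemma rpoch_prod_neq0 (l : list R) (k : nat) :
  (forall a n, In a l -> a + INR n <> 0) -> rpoch_prod l k <> 0.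
Proof.
unfold rpoch_prod; induction l as [|a l IH]; simpl; intros H; [lra|].
apply Rmult_integral_contrapositive; split.
- apply rpoch_neq0; intros n; apply H; now left.
- apply IH; intros b n Hb; apply H; now right.
Qed.

Lemma shift_prod_neq0 (l : list R) (k : nat) :
  (forall a n, In a l -> a + INR n <> 0) -> shift_prod l k <> 0.
Proof.
unfold shift_prod; induction l as [|a l IH]; simpl; intros H; [lra|].
apply Rmult_integral_contrapositive; split.
- apply H; now left.
- apply IH; intros b n Hb; apply H; now right.
Qed.

Lemma rpoch_prod_0 (l : list R) : rpoch_prod l 0 = 1.
Proof.
unfold rpoch_prod; induction l as [|a l IH]; simpl in *; [ring|]; rewrite IH; ring.
Qed.

Lemma hyp_coef_0 (a b : list R) : hyp_coef a b 0 = 1.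
Proof.
unfold hyp_coef; rewrite !rpoch_prod_0; simpl; field.
Qed.

Lemma hyp_coef_S (a b : list R) (k : nat) :
  (forall c n, In c b -> c + INR n <> 0) ->
  hyp_coef a b (S k) =
  hyp_coef a b k * (shift_prod a k / (shift_prod b k * (INR k + 1))).
Proof.
intros H; unfold hyp_coef; rewrite !rpoch_prod_S, fact_simpl, mult_INR, S_INR.
assert (INR k + 1 <> 0) by (generalize (pos_INR k); lra).
assert (Hf := INR_fact_neq_0 k).
assert (Hs := shift_prod_neq0 b k H).
assert (Hp := rpoch_prod_neq0 b k H).
now field.
Qed.

Definition bessel_coef (c : R) : fps := hyp_coef [] [c + 1].

Lemma bessel_coef_theta (c : R) :
  (forall n, c + 1 + INR n <> 0) ->
  let A := bessel_coef c in
  (theta theta A = fps_X * A - c%:F * theta A)%fps.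
Proof.
intros Hc A; apply functional_extensionality; intros [|n].
- unfold fps_theta, fps_sub; rewrite fps_mul_constl; simpl; ring.
- unfold fps_sub; rewrite fps_mul_Xl, fps_mul_constl; unfold fps_theta, A, bessel_coef.
  rewrite hyp_coef_S, S_INR by (intros d m [<-|[]]; apply Hc).
  unfold shift_prod; simpl.
  assert (INR n + 1 <> 0) by (generalize (pos_INR n); lra).
  assert (H1 := Hc n); now field.
Qed.

(* Minus the logarithmic derivative of [/ rpoch c k] with respect to [c]. *)
Fixpoint shifted_harmonic (c : R) (k : nat) : R :=
  match k with
  | O => 0
  | S j => shifted_harmonic c j + / (c + INR j)
  end.

(** Here [S = A - 2 c dA/dc]. Differentiating [(theta^2 + c theta - x) A = 0] in [c] gives [(theta^2
    + c theta - x) dA/dc = - theta A], which explains the source term [2 c theta A]. On coefficients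
    it is a direct check. *)
Lemma bessel_harmonic_theta (c : R) :
  (forall n, c + 1 + INR n <> 0) ->
  let A := bessel_coef c in
  let S := fun k => A k * (1 + 2 * c * shifted_harmonic (c + 1) k) in
  (theta theta S = fps_X * S - c%:F * theta S + 2%:F * c%:F * theta A)%fps.
Proof.
intros Hc A S; apply functional_extensionality; intros [|n];
  unfold fps_add, fps_sub; rewrite <- fps_mulA, !fps_mul_constl.
- unfold fps_theta; simpl; ring.
- rewrite fps_mul_Xl; unfold fps_theta, S, A, bessel_coef.
  rewrite hyp_coef_S, S_INR by (intros d m [<-|[]]; apply Hc).
  unfold shift_prod; simpl.
  assert (INR n + 1 <> 0) by (generalize (pos_INR n); lra).
  assert (H1 := Hc n); now field.
Qed.

(** The symmetric square of a second-order equation has order three. It is kept in the factored form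
    [(theta + 2c) theta (theta + c) P = 2x (2 theta + 1 + 2c) P], whose linear factors become the
    parameters of a hypergeometric series. *)
Lemma bessel_square_theta (c : R) (A : fps) :
  (theta theta A = fps_X * A - c%:F * theta A)%fps ->
  let U := (theta theta (A * A) + c%:F * theta (A * A))%fps in
  (theta U + 2%:F * c%:F * U =
   2%:F * fps_X * (2%:F * theta (A * A) + A * A + 2%:F * c%:F * (A * A)))%fps.
Proof.
intros HA U; unfold U.
repeat (rewrite ?fps_theta_sub, ?fps_theta_add, ?fps_theta_mul, ?fps_theta_const,
  ?fps_theta_X, ?HA); ring.
Qed.

(** The same symmetric square applied to the product of [A] and [x^(-c) B]: removing the power
    [x^(-c)] replaces [theta] by [theta - c], which gives [theta (theta^2 - c^2) P = 2x (2 theta +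
    1) P]. *)
Lemma bessel_product_theta (c : R) (A B : fps) :
  (theta theta A = fps_X * A - c%:F * theta A)%fps ->
  (theta theta B = fps_X * B + c%:F * theta B)%fps ->
  let P := (A * B)%fps in
  (theta theta theta P = c%:F * c%:F * theta P + 2%:F * fps_X * (P + 2%:F * theta P))%fps.
Proof.
intros HA HB P; unfold P.
repeat (rewrite ?fps_theta_sub, ?fps_theta_add, ?fps_theta_mul, ?fps_theta_const,
  ?fps_theta_X, ?HA, ?HB); ring.
Qed.

Lemma bessel_square_rec (c : R) (A : fps) (n : nat) :
  (theta theta A = fps_X * A - c%:F * theta A)%fps ->
  let P := (A * A)%fps in
  (INR n + 1) * (INR n + 1 + c) * (INR n + 1 + 2 * c) * P (S n) =
  2 * (2 * INR n + 1 + 2 * c) * P n.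
Proof.
intros HA P.
generalize (f_equal (fun u => u (S n)) (bessel_square_theta c A HA)).
fold P; rewrite <- !fps_mulA.
unfold fps_add; repeat (rewrite ?fps_mul_constl, ?fps_mul_Xl; unfold fps_theta at 1).
rewrite S_INR; intros H; lra.
Qed.

Lemma bessel_product_rec (c : R) (A B : fps) (n : nat) :
  (theta theta A = fps_X * A - c%:F * theta A)%fps ->
  (theta theta B = fps_X * B + c%:F * theta B)%fps ->
  let P := (A * B)%fps in
  (INR n + 1) * ((INR n + 1) * (INR n + 1) - c * c) * P (S n) =
  2 * (2 * INR n + 1) * P n.
Proof.
intros HA HB P.
generalize (f_equal (fun u => u (S n)) (bessel_product_theta c A B HA HB)).
fold P; rewrite <- !fps_mulA.
unfold fps_add; repeat (rewrite ?fps_mul_constl, ?fps_mul_Xl; unfold fps_theta at 1).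
rewrite S_INR; intros H; lra.
Qed.

(* [_2F_3] and [_3F_4] of the theorem at argument [-z^2 = 4 x], as power series
   in [x = - (z/2)^2]. *)
Definition hyp23 (nu : R) (k : nat) : R :=
  hyp_coef [nu; nu + 1 / 2] [nu + 1; nu + 1; 2 * nu + 1] k * 4 ^ k.

Definition hyp34 (nu : R) (k : nat) : R :=
  hyp_coef [1; 1; 3 / 2] [2; 2; 2 - nu; 2 + nu] k * 4 ^ k.

Lemma hyp23_S (nu : R) (k : nat) : 0 < nu ->
  hyp23 nu (S k) = hyp23 nu k *
  (4 * (nu + INR k) * (nu + INR k + 1 / 2) /
   ((nu + 1 + INR k) * (nu + 1 + INR k) * (2 * nu + 1 + INR k) * (INR k + 1))).
Proof.
intros Hnu; unfold hyp23; rewrite hyp_coef_S.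
- unfold shift_prod; simpl; generalize (pos_INR k); intros Hk.
  field; repeat split; lra.
- intros d m Hd; generalize (pos_INR m); simpl in Hd.
  destruct Hd as [<-|[<-|[<-|[]]]]; lra.
Qed.

Lemma nonint_shift (x : R) (n : nat) : (forall m : Z, x <> IZR m) -> x + INR n <> 0.
Proof.
intros H E; apply (H (- Z.of_nat n)%Z).
rewrite opp_IZR, <- INR_IZR_INZ; lra.
Qed.

Lemma nonint_opp_shift (x : R) (k : Z) (n : nat) :
  (forall m : Z, x <> IZR m) -> IZR k - x + INR n <> 0.
Proof.
intros H E; apply (H (k + Z.of_nat n)%Z).
rewrite plus_IZR, <- INR_IZR_INZ; lra.
Qed.

Lemma hyp34_S (nu : R) (k : nat) : 0 < nu -> (forall n : Z, nu <> IZR n) ->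
  hyp34 nu (S k) = hyp34 nu k *
  (4 * (INR k + 1) * (INR k + 3 / 2) /
   ((INR k + 2) * (INR k + 2) * (2 - nu + INR k) * (2 + nu + INR k))).
Proof.
intros Hnu HZ; unfold hyp34; rewrite hyp_coef_S.
- unfold shift_prod; simpl; generalize (pos_INR k); intros Hk.
  assert (H2 := nonint_opp_shift nu 2 k HZ).
  field; repeat split; lra.
- intros d m Hd; generalize (pos_INR m); simpl in Hd.
  destruct Hd as [<-|[<-|[<-|[<-|[]]]]]; try lra.
  intros _; now apply nonint_opp_shift.
Qed.

(** By its recurrence [A * A] is [_1F_2(nu+1/2; nu+1, 2nu+1; 4x)]. Solving [(theta + nu) f = nu A^2]
    multiplies coefficient [n] by [nu / (n + nu)], that is, adds an upper parameter [nu] and a lower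
    parameter [nu + 1]. *)
Lemma hyp23_theta (nu : R) (A : fps) :
  0 < nu -> (theta theta A = fps_X * A - nu%:F * theta A)%fps -> A O = 1 ->
  (theta (hyp23 nu) = nu%:F * (A * A - hyp23 nu))%fps.
Proof.
intros Hnu HA HA0; apply functional_extensionality; intros n.
rewrite fps_mul_constl; unfold fps_sub, fps_theta.
enough (H : (A * A)%fps n = (INR n + nu) / nu * hyp23 nu n).
{ rewrite H; field; lra. }
induction n as [|n IH].
- simpl; rewrite HA0; unfold hyp23; rewrite hyp_coef_0; simpl; field; lra.
- generalize (pos_INR n); intros Hn.
  assert (H := bessel_square_rec nu A n HA); cbv zeta in H.
  rewrite IH in H.
  assert (Hp : (INR n + 1) * (INR n + 1 + nu) * (INR n + 1 + 2 * nu) <> 0).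
  { repeat apply Rmult_integral_contrapositive_currified; lra. }
  apply (Rmult_eq_reg_l ((INR n + 1) * (INR n + 1 + nu) * (INR n + 1 + 2 * nu))); [|exact Hp].
  rewrite H, hyp23_S, S_INR by assumption.
  field; repeat split; lra.
Qed.

(* [x / (1 - nu^2) * _3F_4 (4 x)]. *)
Definition hyp34_shifted (nu : R) : fps :=
  (fps_X * (/ (1 - nu ^ 2))%:F * hyp34 nu)%fps.

(** By its recurrence [A * B] is [_1F_2(1/2; 1-nu, 1+nu; 4x)]. Dropping the constant term shifts
    every parameter by one and leaves the first coefficient [2 / (1 - nu^2)], the source of the
    prefactor. Dividing coefficient [n + 1] by [2 (n + 1)] and restoring the factorial produce the
    parameters 1, 1 over 2, 2. *)
Lemma hyp34_theta (nu : R) (A B : fps) :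
  0 < nu -> (forall n : Z, nu <> IZR n) ->
  (theta theta A = fps_X * A - nu%:F * theta A)%fps -> A O = 1 ->
  (theta theta B = fps_X * B + nu%:F * theta B)%fps -> B O = 1 ->
  (2%:F * theta (hyp34_shifted nu) = A * B - 1%:F)%fps.
Proof.
intros Hnu HZ HA HA0 HB HB0; apply functional_extensionality; intros [|n];
  rewrite fps_mul_constl; unfold fps_sub, fps_theta.
{ simpl; rewrite HA0, HB0; ring. }
assert (H1 : 1 - nu ^ 2 <> 0).
{ replace (1 - nu ^ 2) with ((1 - nu) * (1 + nu)) by ring.
  generalize (HZ 1%Z); intros; apply Rmult_integral_contrapositive; lra. }
assert (H1' : 1 - nu * nu <> 0) by (simpl in H1; lra).
enough (H : (A * B)%fps (S n) = 2 * (INR n + 1) / (1 - nu ^ 2) * hyp34 nu n).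
{ rewrite H; unfold hyp34_shifted.
  rewrite <- fps_mulA, fps_mul_Xl, fps_mul_constl, S_INR.
  change (fps_const 1 (S n)) with 0; now field. }
assert (Hm : forall m, INR m + 1 - nu <> 0).
{ intros m Hm; apply (nonint_opp_shift nu 1 m HZ); lra. }
assert (Hr := fun n => bessel_product_rec nu A B n HA HB); cbv zeta in Hr.
assert (Hp : forall m, (INR m + 1) * ((INR m + 1) * (INR m + 1) - nu * nu) <> 0).
{ intros m; replace ((INR m + 1) * (INR m + 1) - nu * nu)
    with ((INR m + 1 - nu) * (INR m + 1 + nu)) by ring.
  generalize (pos_INR m) (Hm m); intros.
  repeat apply Rmult_integral_contrapositive_currified; lra. }
induction n as [|n IH].
- apply (Rmult_eq_reg_l ((INR 0 + 1) * ((INR 0 + 1) * (INR 0 + 1) - nu * nu))); [|apply Hp].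
  rewrite Hr; unfold hyp34; rewrite hyp_coef_0; simpl; rewrite HA0, HB0.
  now field.
- apply (Rmult_eq_reg_l ((INR (S n) + 1) * ((INR (S n) + 1) * (INR (S n) + 1) - nu * nu))); [|apply Hp].
  rewrite Hr, IH, hyp34_S, S_INR by assumption.
  generalize (pos_INR n) (Hm (S n)); rewrite S_INR; intros.
  field; repeat split; try lra.
Qed.

Lemma bessel_hyp_identity (nu : R) :
  0 < nu -> (forall n : Z, nu <> IZR n) ->
  ((fun k => (bessel_coef nu k * (1 + 2 * nu * shifted_harmonic (nu + 1) k))%R) =
   bessel_coef (- nu) * hyp23 nu
   - 2%:F * nu%:F * (bessel_coef nu * hyp34_shifted nu))%fps.
Proof.
intros Hnu HZ.
assert (H1 : forall n, nu + 1 + INR n <> 0) by (intros n; generalize (pos_INR n); lra).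
assert (H2 : forall n, - nu + 1 + INR n <> 0).
{ intros m Hm; apply (nonint_opp_shift nu 1 m HZ); lra. }
assert (HA := bessel_coef_theta nu H1).
assert (HA0 : bessel_coef nu O = 1) by apply hyp_coef_0.
assert (HB0 : bessel_coef (- nu) O = 1) by apply hyp_coef_0.
assert (HB := bessel_coef_theta (- nu) H2); cbv zeta in HA, HB.
(* For [ring], [(- nu)%:F] would be an atom unrelated to [nu%:F]. *)
replace ((- nu)%:F)%fps with (0%:F - nu%:F)%fps in HB
  by (apply functional_extensionality; intros [|n]; unfold fps_sub; simpl; ring).
assert (HB' : (theta theta (bessel_coef (- nu)) = fps_X * bessel_coef (- nu)
   + nu%:F * theta (bessel_coef (- nu)))%fps) by (rewrite HB; ring).
apply fps_bessel_identity; trivial.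
- apply (bessel_harmonic_theta nu H1).
- simpl; rewrite HA0; ring.
- now apply hyp23_theta.
- unfold hyp23; rewrite hyp_coef_0; simpl; ring.
- now apply hyp34_theta.
- unfold hyp34_shifted; simpl; ring.
Qed.

(** * The Gamma function from Gauss's limit *)

Lemma ex_series_le_abs (a b : nat -> R) :
  (forall k, Rabs (a k) <= b k) -> ex_series b -> ex_series a.
Proof.
intros H Hb; exact (@ex_series_le R_AbsRing R_CompleteNormedModule a b H Hb).
Qed.

(** Second-order remainders [M k * h^2] with summable [M] add up, so the difference quotient of the
    sum is within [Series M * |h|] of [Series d]. No uniform convergence of derivatives is
    involved. *)
Lemma is_derive_Series (f : nat -> R -> R) (d M : nat -> R) (x delta : R) :
  0 < delta ->
  (forall k h, Rabs h < delta ->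
     Rabs (f k (x + h) - f k x - h * d k) <= M k * (h * h)) ->
  ex_series M -> ex_series d ->
  (forall h, Rabs h < delta -> ex_series (fun k => f k (x + h))) ->
  is_derive (fun y => Series (fun k => f k y)) x (Series d).
Proof.
intros Hdelta Hf HM Hd Hex.
apply is_derive_Reals; intros eps Heps.
assert (HM0 : forall k, 0 <= M k).
{ intros k; set (h := delta / 2).
  assert (Hh : Rabs h < delta) by (unfold h; rewrite Rabs_pos_eq; lra).
  generalize (Hf k h Hh) (Rabs_pos (f k (x + h) - f k x - h * d k)); intros H1 H2.
  apply Rmult_le_reg_r with (h * h); [unfold h; nra | lra]. }
assert (HS : 0 <= Series M).
{ rewrite <- (Rmult_0_l (Series M)), <- Series_scal_l.
  apply Series_le; [|exact HM]; intros k; generalize (HM0 k); lra. }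
(* The added 1 keeps the denominator positive when [Series M] is 0. *)
assert (Hp : 0 < Rmin delta (eps / (Series M + 1))).
{ apply Rmin_case; [lra|]; apply Rdiv_lt_0_compat; lra. }
exists (mkposreal _ Hp); intros h Hh0 Hh; simpl in Hh.
assert (Hh1 : Rabs h < delta) by (eapply Rlt_le_trans; [exact Hh|apply Rmin_l]).
assert (Hh2 : Rabs h < eps / (Series M + 1)) by (eapply Rlt_le_trans; [exact Hh|apply Rmin_r]).
assert (Hx : ex_series (fun k => f k x)).
{ apply ex_series_ext with (fun k => f k (x + 0)).
  - intros k; now rewrite Rplus_0_r.
  - apply Hex; rewrite Rabs_R0; lra. }
assert (Hxh := Hex h Hh1).
assert (Hscal : ex_series (fun k => h * d k)) by (apply (ex_series_scal_l h d); exact Hd).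
assert (Hm : ex_series (fun k => f k (x + h) - f k x))
  by (apply (ex_series_minus (fun k => f k (x + h)) (fun k => f k x)); assumption).
assert (E : (Series (fun k => f k (x + h)) - Series (fun k => f k x)) / h - Series d =
  Series (fun k => f k (x + h) - f k x - h * d k) / h).
{ rewrite Series_minus, Series_minus, Series_scal_l by assumption.
  now field. }
rewrite E; unfold Rdiv; rewrite Rabs_mult, Rabs_inv.
assert (HMh : ex_series (fun k => M k * (h * h))).
{ apply (ex_series_scal_r (h * h) M); exact HM. }
assert (Hle : Rabs (Series (fun k => f k (x + h) - f k x - h * d k)) <= Series M * (h * h)).
{ rewrite <- Series_scal_r.
  eapply Rle_trans; [apply Series_Rabs|].
  - apply (ex_series_le_abs _ (fun k => M k * (h * h))); [|exact HMh].
    intros k; rewrite Rabs_Rabsolu; now apply Hf.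
  - apply Series_le; [|exact HMh].
    intros k; split; [apply Rabs_pos | now apply Hf]. }
assert (Hah : 0 < Rabs h) by now apply Rabs_pos_lt.
apply Rle_lt_trans with (Series M * Rabs h).
- apply Rmult_le_reg_r with (Rabs h); [exact Hah|].
  rewrite Rmult_assoc, Rinv_l, Rmult_1_r by lra.
  eapply Rle_trans; [exact Hle|].
  rewrite Rmult_assoc, <- Rabs_mult, (Rabs_pos_eq (h * h)) by nra; lra.
- apply Rmult_lt_compat_r with (r := Series M + 1) in Hh2; [|lra].
  unfold Rdiv in Hh2; rewrite Rmult_assoc, Rinv_l in Hh2 by lra.
  nra.
Qed.

Lemma is_lim_seq_inv_INR : is_lim_seq (fun n => / INR n) 0.
Proof.
replace (Finite 0) with (Rbar_inv p_infty) by reflexivity.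
apply is_lim_seq_inv; [apply is_lim_seq_INR | discriminate].
Qed.

(** The common majorant of the series attached to [ln Gamma]: for [c = 1] the partial sums telescope
    to [1 - 1/(n+2)]. *)
Lemma ex_series_telescope (c : R) :
  ex_series (fun k => c / ((INR k + 1) * (INR k + 2))).
Proof.
apply ex_series_ext with (fun k => c * / ((INR k + 1) * (INR k + 2))); [reflexivity|].
apply (ex_series_scal_l c (fun k => / ((INR k + 1) * (INR k + 2)))).
exists 1; change (is_lim_seq (sum_n (fun k => / ((INR k + 1) * (INR k + 2)))) 1).
apply (is_lim_seq_ext (fun n => 1 - / (INR n + 2))).
- intros n; induction n as [|n IH].
  + rewrite sum_O; simpl; field.
  + rewrite sum_Sn, <- IH, S_INR; unfold plus; simpl.
    generalize (pos_INR n); intros; field; lra.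
- replace (Finite 1) with (Rbar_minus 1 0) by (simpl; f_equal; ring).
  apply is_lim_seq_minus'; [apply is_lim_seq_const|].
  apply (is_lim_seq_ext (fun n => / INR (n + 2))).
  + intros n; rewrite plus_INR; reflexivity.
  + apply (is_lim_seq_incr_n (fun n => / INR n)), is_lim_seq_inv_INR.
Qed.

Lemma ln_1p_le (u : R) : -1 < u -> ln (1 + u) <= u.
Proof.
intros Hu; rewrite <- (ln_exp u) at 2.
apply ln_le; [lra | apply exp_ineq1_le].
Qed.

Lemma ln_1p_ge (u : R) : -1 < u -> u / (1 + u) <= ln (1 + u).
Proof.
intros Hu; assert (H : - ln (1 + u) <= - (u / (1 + u))); [|lra].
rewrite <- ln_Rinv by lra.
replace (/ (1 + u)) with (1 + - (u / (1 + u))) by (field; lra).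
apply ln_1p_le.
apply Ropp_lt_cancel; rewrite !Ropp_involutive.
apply Rmult_lt_reg_r with (1 + u); [lra|].
unfold Rdiv; rewrite Rmult_assoc, Rinv_l; lra.
Qed.

(** The two first-order bounds give [0 <= t - ln (1 + t) <= t^2 / (1 + t)], and [1 + t] is at least
    one half. *)
Lemma ln_1p_second_order (t : R) : - / 2 <= t -> Rabs (ln (1 + t) - t) <= 2 * (t * t).
Proof.
intros Ht; assert (H1 := ln_1p_le t ltac:(lra)); assert (H2 := ln_1p_ge t ltac:(lra)).
rewrite Rabs_left1 by lra.
assert (H3 : t - t / (1 + t) <= 2 * (t * t)); [|lra].
apply Rmult_le_reg_r with (1 + t); [lra|].
replace ((t - t / (1 + t)) * (1 + t)) with (t * t) by (field; lra).
assert (0 <= t * t) by nra; nra.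
Qed.

Definition gauss (x : R) (n : nat) : R :=
  INR (fact n) * Rpower (INR n) x / prod_f_R0 (fun j => x + INR j) n.

(* Logarithm of [gauss x (k + 2) / gauss x (k + 1)]. *)
Definition lngamma_term (k : nat) (x : R) : R :=
  x * ln ((INR k + 2) / (INR k + 1)) - ln (1 + x / (INR k + 2)).

Definition lngamma_term_deriv (k : nat) (x : R) : R :=
  ln ((INR k + 2) / (INR k + 1)) - / (x + INR k + 2).

Lemma ln_ratio_bounds (k : nat) :
  / (INR k + 2) <= ln ((INR k + 2) / (INR k + 1)) <= / (INR k + 1).
Proof.
assert (Hk := pos_INR k).
assert (H : 0 < / (INR k + 1)) by (apply Rinv_0_lt_compat; lra).
replace ((INR k + 2) / (INR k + 1)) with (1 + / (INR k + 1)) by (field; lra).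
split; [|apply ln_1p_le; lra].
replace (/ (INR k + 2)) with (/ (INR k + 1) / (1 + / (INR k + 1))) by (field; lra).
apply ln_1p_ge; lra.
Qed.

Lemma lngamma_term_bound (k : nat) (x : R) : 0 < x ->
  0 <= lngamma_term k x <= x * (x + 1) / ((INR k + 1) * (INR k + 2)).
Proof.
intros Hx; assert (Hk := pos_INR k); unfold lngamma_term.
destruct (ln_ratio_bounds k) as [H1 H2].
assert (H : 0 < x / (INR k + 2)) by (apply Rdiv_lt_0_compat; lra).
assert (H3 := ln_1p_le (x / (INR k + 2)) ltac:(lra)).
assert (H4 := ln_1p_ge (x / (INR k + 2)) ltac:(lra)).
split.
- assert (x * / (INR k + 2) <= x * ln ((INR k + 2) / (INR k + 1)))
    by (apply Rmult_le_compat_l; lra).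
  unfold Rdiv in *; lra.
- assert (x * ln ((INR k + 2) / (INR k + 1)) <= x * / (INR k + 1))
    by (apply Rmult_le_compat_l; lra).
  apply Rle_trans with (x * / (INR k + 1) - x / (INR k + 2) / (1 + x / (INR k + 2))); [lra|].
  replace (x * / (INR k + 1) - x / (INR k + 2) / (1 + x / (INR k + 2)))
    with (x * (x + 1) / ((INR k + 1) * (x + INR k + 2))) by (field; lra).
  unfold Rdiv; apply Rmult_le_compat_l; [nra|].
  apply Rinv_le_contravar; nra.
Qed.

Lemma lngamma_term_deriv_bound (k : nat) (x : R) : 0 < x ->
  0 <= lngamma_term_deriv k x <= (x + 1) / ((INR k + 1) * (INR k + 2)).
Proof.
intros Hx; assert (Hk := pos_INR k); unfold lngamma_term_deriv.
destruct (ln_ratio_bounds k) as [H1 H2]; split.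
- assert (/ (x + INR k + 2) <= / (INR k + 2)) by (apply Rinv_le_contravar; lra); lra.
- apply Rle_trans with (/ (INR k + 1) - / (x + INR k + 2)); [lra|].
  replace (/ (INR k + 1) - / (x + INR k + 2))
    with ((x + 1) / ((INR k + 1) * (x + INR k + 2))) by (field; lra).
  unfold Rdiv; apply Rmult_le_compat_l; [lra|].
  apply Rinv_le_contravar; nra.
Qed.

Lemma ex_series_lngamma (x : R) : 0 < x -> ex_series (fun k => lngamma_term k x).
Proof.
intros Hx; apply (ex_series_le_abs _ (fun k => x * (x + 1) / ((INR k + 1) * (INR k + 2))));
  [|apply ex_series_telescope].
intros k.
destruct (lngamma_term_bound k x Hx); rewrite Rabs_pos_eq; assumption.
Qed.

Lemma ex_derive_lngamma (x : R) : 0 < x ->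
  ex_derive (fun y => Series (fun k => lngamma_term k y)) x.
Proof.
intros Hx; exists (Series (fun k => lngamma_term_deriv k x)).
apply (is_derive_Series lngamma_term _ (fun k => 2 / ((INR k + 1) * (INR k + 2))) x (Rmin x 1)).
- apply Rmin_case; lra.
- intros k h Hh; assert (Hk := pos_INR k).
  assert (Hh1 : Rabs h < x) by (eapply Rlt_le_trans; [exact Hh|apply Rmin_l]).
  assert (Hh2 : Rabs h < 1) by (eapply Rlt_le_trans; [exact Hh|apply Rmin_r]).
  apply Rabs_def2 in Hh1; apply Rabs_def2 in Hh2.
  set (Y := x + INR k + 2).
  assert (HY : INR k + 2 < Y) by (unfold Y; lra).
  (* This factorization cancels everything in the remainder except [h/Y - ln (1 + h/Y)]. Since
     [|h| < 1] and [Y > 2], the second-order bound applies to [h/Y]. *)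
  assert (Hprod : 1 + (x + h) / (INR k + 2) = (1 + x / (INR k + 2)) * (1 + h / Y))
    by (unfold Y; field; lra).
  assert (Ht : - / 2 <= h / Y).
  { apply Rmult_le_reg_r with Y; [lra|]; unfold Rdiv; rewrite Rmult_assoc, Rinv_l by lra; lra. }
  assert (0 < x / (INR k + 2)) by (apply Rdiv_lt_0_compat; lra).
  replace (lngamma_term k (x + h) - lngamma_term k x - h * lngamma_term_deriv k x)
    with (- (ln (1 + h / Y) - h / Y)).
  + rewrite Rabs_Ropp; eapply Rle_trans; [now apply ln_1p_second_order|].
    replace (2 * (h / Y * (h / Y))) with (2 * (h * h) * / (Y * Y)) by (field; lra).
    replace (2 / ((INR k + 1) * (INR k + 2)) * (h * h))
      with (2 * (h * h) * / ((INR k + 1) * (INR k + 2))) by (field; lra).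
    apply Rmult_le_compat_l; [nra|]; apply Rinv_le_contravar; nra.
  + unfold lngamma_term, lngamma_term_deriv; rewrite Hprod, ln_mult by lra.
    fold Y; unfold Rdiv; ring.
- apply ex_series_telescope.
- apply (ex_series_le_abs _ (fun k => (x + 1) / ((INR k + 1) * (INR k + 2))));
  [|apply ex_series_telescope].
  intros k.
  destruct (lngamma_term_deriv_bound k x Hx); rewrite Rabs_pos_eq; assumption.
- intros h Hh; apply ex_series_lngamma.
  assert (Hh1 : Rabs h < x) by (eapply Rlt_le_trans; [exact Hh|apply Rmin_l]).
  apply Rabs_def2 in Hh1; lra.
Qed.

(** The product of successive ratios starts from [gauss x 1 = 1 / (x (1 + x))], which supplies the
    two logarithms outside the sum; starting at index 0 would involve [ln 0]. *)
Lemma gauss_exp (x : R) (n : nat) : 0 < x ->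
  gauss x (S (S n)) =
  exp (- ln x - ln (1 + x) + sum_n (fun k => lngamma_term k x) n).
Proof.
intros Hx.
assert (Hstep : forall m, gauss x (S (S m)) = gauss x (S m) * exp (lngamma_term m x)).
{ intros m; assert (Hm := pos_INR m); unfold gauss, lngamma_term, Rpower.
  assert (0 < x / (INR m + 2)) by (apply Rdiv_lt_0_compat; lra).
  replace (exp (x * ln ((INR m + 2) / (INR m + 1)) - ln (1 + x / (INR m + 2))))
    with (exp (x * ln (INR m + 2)) / exp (x * ln (INR m + 1)) / (1 + x / (INR m + 2))).
  2: { unfold Rminus; rewrite exp_plus, exp_Ropp, exp_ln by lra.
       rewrite ln_div, Rmult_minus_distr_l by lra.
       unfold Rminus; rewrite exp_plus, exp_Ropp.
       reflexivity. }
  rewrite (fact_simpl (S m)), mult_INR.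
  change (prod_f_R0 (fun j => x + INR j) (S (S m)))
    with (prod_f_R0 (fun j => x + INR j) (S m) * (x + INR (S (S m)))).
  rewrite !S_INR; replace (INR m + 1 + 1) with (INR m + 2) by ring.
  assert (prod_f_R0 (fun j => x + INR j) (S m) <> 0).
  { apply Rgt_not_eq; generalize (S m); intros p; induction p as [|p IH]; simpl; [lra|].
    apply Rmult_lt_0_compat; [exact IH|].
    change (0 < x + INR (S p)); generalize (pos_INR (S p)); lra. }
  generalize (exp_pos (x * ln (INR m + 2))) (exp_pos (x * ln (INR m + 1))); intros.
  field; repeat split; lra. }
induction n as [|n IH].
- rewrite Hstep, sum_O, exp_plus; f_equal.
  unfold gauss, Rpower; simpl; rewrite ln_1, Rmult_0_r, exp_0, Rplus_0_r.
  unfold Rminus; rewrite exp_plus, !exp_Ropp, !exp_ln by lra; field; lra.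
- rewrite Hstep, IH, sum_Sn, <- exp_plus; f_equal; unfold plus; simpl; ring.
Qed.

Lemma gauss_lim_pos (x : R) : 0 < x ->
  is_lim_seq (gauss x)
    (exp (- ln x - ln (1 + x) + Series (fun k => lngamma_term k x))).
Proof.
intros Hx; apply (is_lim_seq_incr_n _ 2).
apply (is_lim_seq_ext
  (fun n => exp (- ln x - ln (1 + x) + sum_n (fun k => lngamma_term k x) n))).
- intros n; rewrite <- gauss_exp by assumption; f_equal; lia.
- apply (is_lim_seq_continuous exp
    (fun n => - ln x - ln (1 + x) + sum_n (fun k => lngamma_term k x) n)).
  + apply derivable_continuous, derivable_exp.
  + apply is_lim_seq_plus'; [apply is_lim_seq_const|].
    apply (Series_correct _ (ex_series_lngamma x Hx)).
Qed.

Lemma Gamma_pos_exp (x : R) : 0 < x ->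
  Gamma x = exp (- ln x - ln (1 + x) + Series (fun k => lngamma_term k x)).
Proof.
intros Hx; unfold Gamma.
change (real (Lim_seq (gauss x)) =
  exp (- ln x - ln (1 + x) + Series (fun k => lngamma_term k x))).
now rewrite (is_lim_seq_unique _ _ (gauss_lim_pos x Hx)).
Qed.

Lemma Gamma_gt0 (x : R) : 0 < x -> 0 < Gamma x.
Proof.
intros Hx; rewrite Gamma_pos_exp by assumption; apply exp_pos.
Qed.

Lemma ex_derive_Gamma (x : R) : 0 < x -> ex_derive Gamma x.
Proof.
intros Hx.
apply ex_derive_ext_loc with
  (fun y => exp (- ln y - ln (1 + y) + Series (fun k => lngamma_term k y))).
- exists (mkposreal x Hx); intros y Hy; symmetry; apply Gamma_pos_exp.
  unfold ball in Hy; simpl in Hy; unfold AbsRing_ball, abs, minus, plus, opp in Hy; simpl in Hy.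
  apply Rabs_def2 in Hy; lra.
- assert (H := ex_derive_lngamma x Hx).
  (* With its body cleared, [g] is for [auto_derive] an arbitrary function, differentiable by
     [H]. *)
  pose (g := fun y => Series (fun k => lngamma_term k y)); change (ex_derive g x) in H.
  change (ex_derive (fun y => exp (- ln y - ln (1 + y) + g y)) x).
  clearbody g; auto_derive; repeat split; trivial; lra.
Qed.

(** The functional equation of Gamma before the limit; the extra factor [n / (x + n + 1)] tends to
    1. *)
Lemma gauss_rec (x : R) (n : nat) : (forall m, x + INR m <> 0) ->
  gauss (x + 1) (S n) = gauss x (S n) * (x * (INR (S n) / (x + INR (S n) + 1))).
Proof.
intros Hx; unfold gauss.
assert (HN : 0 < INR (S n)) by (apply lt_0_INR; lia).
assert (Hprod : forall m, x * prod_f_R0 (fun j => x + 1 + INR j) m =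
  prod_f_R0 (fun j => x + INR j) m * (x + INR m + 1)).
{ intros m; induction m as [|m IH]; [simpl; ring|].
  change (x * (prod_f_R0 (fun j => x + 1 + INR j) m * (x + 1 + INR (S m))) =
    prod_f_R0 (fun j => x + INR j) m * (x + INR (S m)) * (x + INR (S m) + 1)).
  rewrite <- Rmult_assoc, IH, S_INR; ring. }
assert (Hp : forall m, prod_f_R0 (fun j => x + INR j) m <> 0).
{ intros m; induction m as [|m IH]; [apply (Hx O)|].
  change (prod_f_R0 (fun j => x + INR j) m * (x + INR (S m)) <> 0).
  now apply Rmult_integral_contrapositive. }
rewrite Rpower_plus, Rpower_1 by assumption.
specialize (Hprod (S n)); specialize (Hp (S n)).
set (P1 := prod_f_R0 (fun j => x + 1 + INR j) (S n)) in *.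
set (P0 := prod_f_R0 (fun j => x + INR j) (S n)) in *.
assert (Hx0 := Hx O); simpl INR in Hx0; rewrite Rplus_0_r in Hx0.
assert (Hx1 := Hx (S (S n))); rewrite S_INR, <- Rplus_assoc in Hx1.
assert (HP1 : P1 = P0 * (x + INR (S n) + 1) / x) by (rewrite <- Hprod; now field).
rewrite HP1; now field.
Qed.

Lemma INR_unbounded (x : R) : exists n, x < INR n.
Proof.
destruct (nfloor_ex (Rabs x) (Rabs_pos x)) as [n Hn].
exists (S n); rewrite S_INR; generalize (Rle_abs x); lra.
Qed.

Lemma is_lim_seq_shift_ratio (a : R) : is_lim_seq (fun n => (INR n + a) / INR n) 1.
Proof.
apply is_lim_seq_incr_1.
apply (is_lim_seq_ext (fun n => 1 + a * / INR (S n))).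
- intros n; field; apply not_0_INR; lia.
- replace (Finite 1) with (Finite (1 + a * 0)) by (f_equal; ring).
  apply is_lim_seq_plus'; [apply is_lim_seq_const|].
  apply is_lim_seq_mult'; [apply is_lim_seq_const|].
  apply (is_lim_seq_incr_1 (fun n => / INR n)), is_lim_seq_inv_INR.
Qed.

Lemma gauss_lim_back (x l : R) : (forall m, x + INR m <> 0) ->
  is_lim_seq (gauss (x + 1)) l -> is_lim_seq (gauss x) (l / x).
Proof.
intros Hx Hl.
assert (Hx0 := Hx O); simpl INR in Hx0; rewrite Rplus_0_r in Hx0.
apply is_lim_seq_incr_1.
apply (is_lim_seq_ext
  (fun n => gauss (x + 1) (S n) * / x * ((INR (S n) + (x + 1)) / INR (S n)))).
- intros n; rewrite gauss_rec by assumption.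
  assert (Hx1 := Hx (S (S n))); rewrite S_INR, <- Rplus_assoc in Hx1.
  assert (INR (S n) <> 0) by (apply not_0_INR; lia).
  now field.
- replace (Finite (l / x)) with (Finite (l * / x * 1)) by (f_equal; now field).
  apply is_lim_seq_mult'; [apply is_lim_seq_mult'; [|apply is_lim_seq_const]|].
  + now apply (is_lim_seq_incr_1 (gauss (x + 1))).
  + apply (is_lim_seq_incr_1 (fun n => (INR n + (x + 1)) / INR n)).
    apply is_lim_seq_shift_ratio.
Qed.

(** The logarithmic series settles positive [x]; any other admissible [x] becomes positive after
    finitely many unit shifts, and [gauss_lim_back] carries convergence back one shift at a time. *)
Lemma gauss_lim (x : R) : (forall m, x + INR m <> 0) -> is_lim_seq (gauss x) (Gamma x).
Proof.
intros Hx.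
assert (Hex : exists l : R, is_lim_seq (gauss x) l).
{ destruct (INR_unbounded (- x)) as [n Hn].
  revert x Hx Hn; induction n as [|n IH]; intros x Hx Hn.
  - simpl in Hn; eexists; apply gauss_lim_pos; lra.
  - destruct (IH (x + 1)) as [l Hl].
    + intros m; generalize (Hx (S m)); rewrite S_INR; intros H H'; apply H; lra.
    + rewrite S_INR in Hn; lra.
    + exists (l / x); now apply gauss_lim_back. }
destruct Hex as [l Hl].
replace (Gamma x) with l; [exact Hl|].
unfold Gamma; change (l = real (Lim_seq (gauss x))).
now rewrite (is_lim_seq_unique _ _ Hl).
Qed.

Lemma Gamma_rec (x : R) : (forall m, x + INR m <> 0) -> Gamma (x + 1) = x * Gamma x.
Proof.
intros Hx.
assert (Hx0 := Hx O); simpl INR in Hx0; rewrite Rplus_0_r in Hx0.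
assert (Hx1 : forall m, x + 1 + INR m <> 0).
{ intros m; generalize (Hx (S m)); rewrite S_INR; intros H H'; apply H; lra. }
assert (H := gauss_lim_back x _ Hx (gauss_lim _ Hx1)).
apply is_lim_seq_unique in H.
rewrite (is_lim_seq_unique _ _ (gauss_lim x Hx)) in H.
injection H; intros E; rewrite E; now field.
Qed.

(** * The reflection formula *)

(** The integral of an elementary proof of Euler's sine product. Relative to [x = 0], passing from
    exponent [2m - 2] to [2m] multiplies it by [1 / (1 - x^2/m^2)], while for large exponents
    [cos t ^ n] concentrates at 0, where [cos (2 x t)] is 1. *)
Definition cos_int (n : nat) (x : R) : R :=
  RInt (fun t => cos (2 * x * t) * cos t ^ n) 0 (PI / 2).

Lemma is_cos_int (n : nat) (x : R) :
  is_RInt (fun t => cos (2 * x * t) * cos t ^ n) 0 (PI / 2) (cos_int n x).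
Proof.
apply (RInt_correct (V := R_CompleteNormedModule)).
apply (ex_RInt_continuous (V := R_CompleteNormedModule)); intros t _.
apply (ex_derive_continuous (fun t => cos (2 * x * t) * cos t ^ n)).
auto_derive; trivial.
Qed.

Lemma is_RInt_lin2 (f g : R -> R) (a b c d If Ig : R) :
  is_RInt f a b If -> is_RInt g a b Ig ->
  is_RInt (fun t => c * f t - d * g t) a b (c * If - d * Ig).
Proof.
intros Hf Hg; apply (is_RInt_minus (V := R_NormedModule));
  now apply (is_RInt_scal (V := R_NormedModule)).
Qed.

Lemma cos_int_rec (n : nat) (x : R) :
  ((INR n + 2) ^ 2 - 4 * x ^ 2) * cos_int (S (S n)) x =
  (INR n + 2) * (INR n + 1) * cos_int n x.
Proof.
assert (H := is_RInt_lin2 _ _ _ _ ((INR n + 2) ^ 2 - 4 * x ^ 2) ((INR n + 2) * (INR n + 1))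
  _ _ (is_cos_int (S (S n)) x) (is_cos_int n x)).
(* Two integrations by parts condensed into one antiderivative. It vanishes at 0 because of the
   sines and at [PI / 2] because of the powers of the cosine. *)
pose (G := fun t => (INR n + 2) * cos t ^ S n * sin t * cos (2 * x * t)
                    - 2 * x * cos t ^ S (S n) * sin (2 * x * t)).
assert (H0 : minus (G (PI / 2)) (G 0) = 0).
{ unfold G, minus, plus, opp; simpl.
  rewrite cos_PI2, Rmult_0_r, sin_0, cos_0; ring. }
apply Rminus_diag_uniq; rewrite <- (is_RInt_unique _ _ _ _ H).
transitivity (minus (G (PI / 2)) (G 0)); [|exact H0].
apply is_RInt_unique, (is_RInt_derive (V := R_CompleteNormedModule) G).
- intros t _; unfold G; auto_derive; trivial.
  change (match n with O => 1 | S _ => INR n + 1 end) with (INR (S n)).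
  change (cos t ^ S (S n)) with (cos t * (cos t * cos t ^ n)).
  rewrite S_INR; apply Rminus_diag_uniq.
  transitivity ((sin t * sin t + cos t * cos t - 1) * - ((INR n + 2) * (INR n + 1))
     * cos t ^ n * cos (2 * x * t)); [ring|].
  generalize (sin2_cos2 t); unfold Rsqr; intros ->; ring.
- intros t _; apply (ex_derive_continuous (K := R_AbsRing) (V := R_NormedModule)).
  auto_derive; trivial.
Qed.

Lemma mul_cos_le_sin (t : R) : 0 <= t <= PI / 2 -> t * cos t <= sin t.
Proof.
intros [H0 H1]; destruct (Req_dec t 0) as [->|Ht]; [rewrite sin_0; lra|].
destruct (MVT_cor2 (fun t => sin t - t * cos t) (fun t => t * sin t) 0 t) as [c [Hc [Hc0 Hc1]]].
- lra.
- intros c _; apply is_derive_Reals; auto_derive; trivial; ring.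
- assert (0 <= c * sin c * (t - 0)).
  { assert (0 <= sin c) by (apply sin_ge_0; generalize PI_RGT_0; lra).
    repeat apply Rmult_le_pos; lra. }
  rewrite sin_0 in Hc; lra.
Qed.

Lemma one_minus_cos_le (u : R) : 0 <= 1 - cos u <= u * u / 2.
Proof.
split; [generalize (COS_bound u); lra|].
replace u with (2 * (u / 2)) at 1 by field.
rewrite cos_2a_sin.
assert (Hs : sin (u / 2) * sin (u / 2) <= u / 2 * (u / 2)).
{ apply Rsqr_le_abs_1; set (v := u / 2).
  destruct (Rtotal_order v 0) as [H|[->|H]].
  - assert (H1 := sin_gt_x v H); assert (H2 := sin_lt_x (- v) ltac:(lra)).
    rewrite sin_neg in H2; apply Rabs_le; rewrite Rabs_left by assumption.
    destruct (Rle_dec 0 (sin v)); [|lra].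
    destruct (Rlt_dec v (- PI)) as [|Hv]; [generalize (SIN_bound v) PI_4 PI2_1; lra|].
    destruct (Req_dec v (- PI)) as [->|]; [rewrite sin_neg, sin_PI; generalize PI_RGT_0; lra|].
    generalize (sin_lt_0_var v ltac:(lra) H); lra.
  - rewrite sin_0, Rabs_R0; lra.
  - assert (H1 := sin_lt_x v H).
    apply Rabs_le; rewrite Rabs_right by lra.
    destruct (Rle_dec (sin v) 0); [|lra].
    destruct (Rlt_dec PI v) as [|Hv]; [generalize (SIN_bound v) PI_4 PI2_1; lra|].
    generalize (sin_ge_0 v ltac:(lra) ltac:(lra)); lra. }
lra.
Qed.

(** Pointwise, [1 - cos (2xt) <= 2 x^2 t^2] and [t cos t <= sin t] give [(1 - cos (2xt)) cos^2 t <=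
    2 x^2 sin^2 t = 2 x^2 (1 - cos^2 t)]; multiply by [cos t ^ n] and integrate. *)
Lemma cos_int_diff (n : nat) (x : R) :
  Rabs (cos_int (S (S n)) 0 - cos_int (S (S n)) x) <=
  2 * x ^ 2 * (cos_int n 0 - cos_int (S (S n)) 0).
Proof.
assert (H1 := is_RInt_lin2 _ _ _ _ 1 1 _ _ (is_cos_int (S (S n)) 0) (is_cos_int (S (S n)) x)).
assert (H2 := is_RInt_lin2 _ _ _ _ (2 * x ^ 2) (2 * x ^ 2) _ _ (is_cos_int n 0) (is_cos_int (S (S n)) 0)).
assert (HPI := PI_RGT_0).
replace (cos_int (S (S n)) 0 - cos_int (S (S n)) x) with
  (1 * cos_int (S (S n)) 0 - 1 * cos_int (S (S n)) x) by ring.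
replace (2 * x ^ 2 * (cos_int n 0 - cos_int (S (S n)) 0)) with
  (2 * x ^ 2 * cos_int n 0 - 2 * x ^ 2 * cos_int (S (S n)) 0) by ring.
rewrite <- (is_RInt_unique _ _ _ _ H1), <- (is_RInt_unique _ _ _ _ H2).
assert (Hp : forall t, 0 < t < PI / 2 ->
  0 <= 1 * (cos (2 * 0 * t) * cos t ^ S (S n)) - 1 * (cos (2 * x * t) * cos t ^ S (S n))
  <= 2 * x ^ 2 * (cos (2 * 0 * t) * cos t ^ n) - 2 * x ^ 2 * (cos (2 * 0 * t) * cos t ^ S (S n))).
{ intros t Ht; replace (2 * 0 * t) with 0 by ring; rewrite cos_0.
  assert (Hc : 0 <= cos t) by (apply cos_ge_0; lra).
  assert (Hcn : 0 <= cos t ^ n) by now apply pow_le.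
  assert (Hk := one_minus_cos_le (2 * x * t)).
  assert (Hs := mul_cos_le_sin t ltac:(lra)).
  assert (H2c := sin2_cos2 t); unfold Rsqr in H2c.
  assert (Hsc : t * t * (cos t * cos t) <= 1 - cos t * cos t).
  { replace (1 - cos t * cos t) with (sin t * sin t) by lra.
    replace (t * t * (cos t * cos t)) with ((t * cos t) * (t * cos t)) by ring.
    assert (0 <= t * cos t) by (apply Rmult_le_pos; lra).
    apply Rmult_le_compat; assumption. }
  assert (Hcc : 0 <= cos t * cos t) by nra.
  simpl; split.
  - replace (1 * (1 * (cos t * (cos t * cos t ^ n))) - 1 * (cos (2 * x * t) * (cos t * (cos t * cos t ^ n))))
      with ((1 - cos (2 * x * t)) * (cos t * cos t) * cos t ^ n) by ring.
    repeat apply Rmult_le_pos; lra.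
  - apply Rle_trans with (2 * (x * x) * (t * t * (cos t * cos t)) * cos t ^ n).
    + replace (1 * (1 * (cos t * (cos t * cos t ^ n))) - 1 * (cos (2 * x * t) * (cos t * (cos t * cos t ^ n))))
      with ((1 - cos (2 * x * t)) * (cos t * cos t) * cos t ^ n) by ring.
      apply Rmult_le_compat_r; [assumption|].
      replace (2 * (x * x) * (t * t * (cos t * cos t))) with
        (2 * x * t * (2 * x * t) / 2 * (cos t * cos t)) by field.
      apply Rmult_le_compat_r; lra.
    + replace (2 * (x * (x * 1)) * (1 * cos t ^ n) - 2 * (x * (x * 1)) * (1 * (cos t * (cos t * cos t ^ n))))
        with (2 * (x * x) * (1 - cos t * cos t) * cos t ^ n) by ring.
      apply Rmult_le_compat_r; [assumption|]; apply Rmult_le_compat_l; [nra|assumption]. }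
rewrite Rabs_pos_eq.
- apply RInt_le; [lra|eexists; exact H1|eexists; exact H2|].
  intros t Ht; apply (Hp t Ht).
- apply RInt_ge_0; [lra|eexists; exact H1|].
  intros t Ht; apply (Hp t Ht).
Qed.

Lemma cos_int_0 (x : R) : x <> 0 -> cos_int 0 x = sin (PI * x) / (2 * x).
Proof.
intros Hx; unfold cos_int; apply is_RInt_unique.
pose (G := fun t => sin (2 * x * t) / (2 * x)).
replace (sin (PI * x) / (2 * x)) with (minus (G (PI / 2)) (G 0)).
- apply (is_RInt_derive (V := R_CompleteNormedModule) G).
  + intros t _; unfold G; auto_derive; trivial; simpl; field; exact Hx.
  + intros t _; apply (ex_derive_continuous (K := R_AbsRing) (V := R_NormedModule)).
    auto_derive; trivial.
- unfold G, minus, plus, opp; simpl; rewrite Rmult_0_r, sin_0.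
  replace (2 * x * (PI / 2)) with (PI * x) by field; field; exact Hx.
Qed.

Lemma cos_int_00 : cos_int 0 0 = PI / 2.
Proof.
unfold cos_int; rewrite (RInt_ext _ (fun _ => 1)).
- rewrite RInt_const; unfold scal; simpl; unfold mult; simpl; ring.
- intros t _; replace (2 * 0 * t) with 0 by ring; rewrite cos_0; simpl; ring.
Qed.

Lemma cos_int_even_rec (m : nat) (x : R) :
  ((INR m + 1) ^ 2 - x ^ 2) * cos_int (2 * S m) x =
  (INR m + 1) * (INR m + / 2) * cos_int (2 * m) x.
Proof.
replace (2 * S m)%nat with (S (S (2 * m))) by lia.
assert (H := cos_int_rec (2 * m) x); rewrite mult_INR in H; simpl (INR 2) in H; lra.
Qed.

Lemma cos_int_even_pos (m : nat) : 0 < cos_int (2 * m) 0.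
Proof.
induction m as [|m IH]; [simpl; rewrite cos_int_00; generalize PI_RGT_0; lra|].
assert (Hm := pos_INR m).
assert (H := cos_int_even_rec m 0).
apply Rmult_lt_reg_l with ((INR m + 1) ^ 2 - 0 ^ 2); [nra|].
rewrite H, Rmult_0_r; repeat apply Rmult_lt_0_compat; lra.
Qed.

(** By the recurrence at [x = 0], [cos_int (2m) 0] exceeds [cos_int (2m+2) 0] by the fraction
    [1/(2m+1)] of the latter. Hence [cos_int_diff] bounds the relative error by [2 x^2 / (2m+1)],
    which is at most [2 x^2 / (m+1)]. *)
Lemma cos_int_ratio_lim (x : R) :
  is_lim_seq (fun m => cos_int (2 * m) x / cos_int (2 * m) 0) 1.
Proof.
apply is_lim_seq_incr_1.
apply (is_lim_seq_ext
  (fun m => 1 - (cos_int (2 * S m) 0 - cos_int (2 * S m) x) / cos_int (2 * S m) 0)).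
{ intros m; field; generalize (cos_int_even_pos (S m)); lra. }
replace (Finite 1) with (Finite (1 - 0)) by (f_equal; ring).
apply is_lim_seq_minus'; [apply is_lim_seq_const|].
apply is_lim_seq_abs_0.
apply (is_lim_seq_le_le (fun _ => 0) _ (fun m => 2 * x ^ 2 * / INR (S m))).
- intros m; split; [apply Rabs_pos|].
  assert (Hm := pos_INR m); assert (Hp := cos_int_even_pos (S m)).
  unfold Rdiv; rewrite Rabs_mult, Rabs_inv, (Rabs_pos_eq (cos_int _ 0)) by lra.
  apply Rmult_le_reg_r with (cos_int (2 * S m) 0); [assumption|].
  rewrite Rmult_assoc, Rinv_l, Rmult_1_r by lra.
  assert (Hd := cos_int_diff (2 * m) x); assert (Hr := cos_int_even_rec m 0).
  replace (2 * S m)%nat with (S (S (2 * m))) in * by lia.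
  eapply Rle_trans; [exact Hd|].
  rewrite !Rmult_assoc; do 2 (apply Rmult_le_compat_l; [nra|]).
  replace (cos_int (2 * m) 0) with ((INR m + 1) / (INR m + / 2) * cos_int (S (S (2 * m))) 0).
  + rewrite S_INR.
    replace ((INR m + 1) / (INR m + / 2) * cos_int (S (S (2 * m))) 0 - cos_int (S (S (2 * m))) 0)
      with (/ (2 * INR m + 1) * cos_int (S (S (2 * m))) 0) by (field; lra).
    apply Rmult_le_compat_r; [lra|]; apply Rinv_le_contravar; lra.
  + apply Rmult_eq_reg_l with ((INR m + 1) * (INR m + / 2)); [|nra].
    rewrite <- Hr; field; lra.
- apply is_lim_seq_const.
- replace (Finite 0) with (Finite (2 * x ^ 2 * 0)) by (f_equal; ring).
  apply is_lim_seq_mult'; [apply is_lim_seq_const|].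
  apply (is_lim_seq_incr_1 (fun n => / INR n)), is_lim_seq_inv_INR.
Qed.

(* [cos_int (2 n) x / cos_int (2 n) 0] is the ratio between [sin (PI x) / (PI x)]
   and its Euler product truncated at [n]. *)
Lemma gauss_reflection (x : R) (n : nat) : (forall m : Z, x <> IZR m) ->
  gauss x (S n) * gauss (1 - x) (S n) * ((INR (S n) + (1 - x)) / INR (S n)) * sin (PI * x) =
  PI * (cos_int (2 * S n) x / cos_int (2 * S n) 0).
Proof.
intros Hx.
assert (H1 : forall m, x + INR m <> 0) by (intros m; now apply nonint_shift).
assert (H2 : forall m, 1 - x + INR m <> 0).
{ intros m; now apply nonint_opp_shift. }
assert (Hx0 := H1 O); simpl INR in Hx0.
pose (p := fun y => prod_f_R0 (fun j => y + INR j)).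
assert (Hp : forall y m, (forall j, y + INR j <> 0) -> p y m <> 0).
{ intros y m Hy; induction m as [|m IH]; [apply (Hy O)|].
  change (p y m * (y + INR (S m)) <> 0); now apply Rmult_integral_contrapositive. }
(* The truncated Euler product with denominators cleared. The case [m = 0] is the explicit integral
   of [cos (2xt)]; the induction step uses [cos_int_even_rec] at [x] and at 0. *)
assert (Hmain : forall m,
  INR (fact m) ^ 2 * (INR m + (1 - x)) * sin (PI * x) * cos_int (2 * m) 0 =
  PI * cos_int (2 * m) x * (p x m * p (1 - x) m)).
{ intros m; induction m as [|m IH].
  - simpl; unfold p; simpl; rewrite cos_int_00, cos_int_0 by lra; field; lra.
  - assert (Hm := pos_INR m).
    change (p x (S m)) with (p x m * (x + INR (S m))).
    change (p (1 - x) (S m)) with (p (1 - x) m * (1 - x + INR (S m))).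
    rewrite fact_simpl, mult_INR, S_INR.
    assert (Hn0 : (INR m + 1) ^ 2 - x ^ 2 <> 0).
    { replace ((INR m + 1) ^ 2 - x ^ 2) with ((1 - x + INR m) * (x + INR (S m)))
        by (rewrite S_INR; ring).
      now apply Rmult_integral_contrapositive. }
    assert (E0 : cos_int (2 * S m) 0 = (INR m + / 2) / (INR m + 1) * cos_int (2 * m) 0).
    { apply Rmult_eq_reg_l with ((INR m + 1) ^ 2 - 0 ^ 2); [|nra].
      rewrite cos_int_even_rec; field; lra. }
    assert (Ex : cos_int (2 * S m) x =
      (INR m + 1) * (INR m + / 2) / ((INR m + 1) ^ 2 - x ^ 2) * cos_int (2 * m) x).
    { apply Rmult_eq_reg_l with ((INR m + 1) ^ 2 - x ^ 2); [|exact Hn0].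
      rewrite cos_int_even_rec; now field. }
    rewrite E0, Ex.
    transitivity (INR (fact m) ^ 2 * (INR m + (1 - x)) * sin (PI * x) * cos_int (2 * m) 0
      * ((INR m + 1) * (INR m + / 2) * (INR m + 1 + (1 - x)) / (INR m + (1 - x)))).
    + assert (H3 := H2 m); field; lra.
    + rewrite IH; assert (H3 := H2 m).
      assert (H4 := H1 (S m)); rewrite S_INR in H4.
      replace ((INR m + 1) ^ 2 - x ^ 2) with ((1 - x + INR m) * (x + (INR m + 1))) by ring.
      field; lra. }
unfold gauss.
change (prod_f_R0 (fun j => x + INR j) (S n)) with (p x (S n)).
change (prod_f_R0 (fun j => 1 - x + INR j) (S n)) with (p (1 - x) (S n)).
specialize (Hmain (S n)).
assert (HN : 0 < INR (S n)) by (apply lt_0_INR; lia).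
assert (HR : Rpower (INR (S n)) x * Rpower (INR (S n)) (1 - x) = INR (S n)).
{ rewrite <- Rpower_plus; replace (x + (1 - x)) with 1 by ring; now apply Rpower_1. }
assert (Hp1 := Hp x (S n) H1); assert (Hp2 := Hp (1 - x) (S n) H2).
assert (Hc := cos_int_even_pos (S n)).
transitivity (INR (fact (S n)) ^ 2 * (Rpower (INR (S n)) x * Rpower (INR (S n)) (1 - x))
  / (p x (S n) * p (1 - x) (S n)) * ((INR (S n) + (1 - x)) / INR (S n)) * sin (PI * x)).
{ field; repeat split; first [assumption | lra]. }
rewrite HR.
apply Rmult_eq_reg_l with (p x (S n) * p (1 - x) (S n) * cos_int (2 * S n) 0).
2: { apply Rmult_integral_contrapositive_currified; [|lra].
     now apply Rmult_integral_contrapositive_currified. }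
transitivity (INR (fact (S n)) ^ 2 * (INR (S n) + (1 - x)) * sin (PI * x) * cos_int (2 * S n) 0).
{ field; repeat split; first [assumption | lra]. }
rewrite Hmain; field; lra.
Qed.

Lemma Gamma_reflection (x : R) : (forall m : Z, x <> IZR m) ->
  Gamma x * Gamma (1 - x) * sin (PI * x) = PI.
Proof.
intros Hx.
assert (H1 : forall m, x + INR m <> 0) by (intros m; now apply nonint_shift).
assert (H2 : forall m, 1 - x + INR m <> 0).
{ intros m; now apply nonint_opp_shift. }
assert (La : is_lim_seq (fun n => gauss x (S n) * gauss (1 - x) (S n) *
   ((INR (S n) + (1 - x)) / INR (S n)) * sin (PI * x)) (Gamma x * Gamma (1 - x) * 1 * sin (PI * x))).
{ apply (is_lim_seq_incr_1 (fun n => gauss x n * gauss (1 - x) n *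
   ((INR n + (1 - x)) / INR n) * sin (PI * x))).
  repeat apply is_lim_seq_mult'; try apply is_lim_seq_const; try now apply gauss_lim.
  apply is_lim_seq_shift_ratio. }
assert (Lb : is_lim_seq (fun n => gauss x (S n) * gauss (1 - x) (S n) *
   ((INR (S n) + (1 - x)) / INR (S n)) * sin (PI * x)) (PI * 1)).
{ apply (is_lim_seq_ext (fun n => PI * (cos_int (2 * S n) x / cos_int (2 * S n) 0))).
  - intros n; symmetry; now apply gauss_reflection.
  - apply is_lim_seq_mult'; [apply is_lim_seq_const|].
    apply (is_lim_seq_incr_1 (fun n => cos_int (2 * n) x / cos_int (2 * n) 0)).
    apply cos_int_ratio_lim. }
apply is_lim_seq_unique in La; apply is_lim_seq_unique in Lb.
rewrite La in Lb; injection Lb; lra.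
Qed.

(** * Evaluation of entire power series *)

Ltac eq_in_R := match goal with |- @eq _ ?a ?b => change (@eq R a b) end.

(** Absolute convergence at every radius, imposed on the real coefficients, controls the real and
    the imaginary parts at every complex point at once. *)
Definition entire (a : fps) : Prop :=
  forall r, 0 <= r -> ex_series (fun k => Rabs (a k) * r ^ k).

Lemma entire_le (a b : fps) : (forall k, Rabs (a k) <= Rabs (b k)) -> entire b -> entire a.
Proof.
intros H Hb r Hr; apply (ex_series_le_abs _ (fun k => Rabs (b k) * r ^ k)); [|now apply Hb].
intros k; rewrite Rabs_mult, Rabs_Rabsolu, (Rabs_pos_eq (r ^ k)) by now apply pow_le.
apply Rmult_le_compat_r; [now apply pow_le | apply H].
Qed.

(** From [N] on, the coefficients are dominated by [D c^k / k!], where [D] makes this an equality at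
    [k = N]; the exponential series then gives convergence. The threshold [N] allows for lower
    parameters such as [1 - nu], whose first shifts can be negative or close to 0. *)
Lemma entire_rec (a : fps) (c : R) (N : nat) : 0 < c ->
  (forall k, (N <= k)%nat -> Rabs (a (S k)) * (INR k + 1) <= c * Rabs (a k)) ->
  entire a.
Proof.
intros Hc H r Hr.
pose (D := Rabs (a N) * INR (fact N) / c ^ N).
assert (HcN : forall k, 0 < c ^ k) by (intros k; now apply pow_lt).
assert (Hb : forall k, Rabs (a (N + k)%nat) <= D * (c ^ (N + k) / INR (fact (N + k)))).
{ intros k; induction k as [|k IH].
  - rewrite Nat.add_0_r; unfold D; right; field; split;
      [apply INR_fact_neq_0 | generalize (HcN N); lra].
  - replace (N + S k)%nat with (S (N + k)) by lia.
    rewrite fact_simpl, mult_INR, S_INR.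
    assert (Hk := pos_INR (N + k)); assert (Hf := INR_fact_lt_0 (N + k)).
    apply Rmult_le_reg_r with (INR (N + k) + 1); [lra|].
    eapply Rle_trans; [apply H; lia|].
    apply Rle_trans with (c * (D * (c ^ (N + k) / INR (fact (N + k))))).
    + apply Rmult_le_compat_l; lra.
    + right; simpl; field; lra. }
apply (ex_series_incr_n _ N).
apply (ex_series_le_abs _ (fun k => D * (c ^ (N + k) / INR (fact (N + k))) * r ^ (N + k))).
- intros k; rewrite Rabs_mult, Rabs_Rabsolu, (Rabs_pos_eq (r ^ _)) by now apply pow_le.
  apply Rmult_le_compat_r; [now apply pow_le | apply Hb].
- apply (ex_series_incr_n (fun k => D * (c ^ k / INR (fact k)) * r ^ k) N).
  apply (ex_series_ext (fun k => D * (/ INR (fact k) * (c * r) ^ k))).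
  + intros k; eq_in_R; rewrite Rpow_mult_distr; unfold Rdiv; ring.
  + apply (ex_series_scal_l D (fun k => / INR (fact k) * (c * r) ^ k)).
    exists (exp (c * r)).
    apply (is_series_ext (fun k => scal (pow_n (c * r) k) (/ INR (fact k)))).
    * intros k; rewrite pow_n_pow; apply Rmult_comm.
    * exact (is_exp_Reals (c * r)).
Qed.

Definition ps_eval (a : fps) (x : C) : C := CSeries (fun k => (RtoC (a k) * x ^ k)%C).

Lemma CSeries_ext (u v : nat -> C) : (forall k, u k = v k) -> CSeries u = CSeries v.
Proof.
intros H; unfold CSeries; f_equal; apply Series_ext; intros k; now rewrite H.
Qed.

Lemma ps_eval_Re (a : fps) (x : C) :
  Re (ps_eval a x) = Series (fun k => a k * Re (x ^ k)%C).
Proof.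
apply Series_ext; intros k; apply re_scal_l.
Qed.

Lemma im_scal (r : R) (c : C) : Im (RtoC r * c)%C = r * Im c.
Proof. destruct c; unfold Im; simpl; ring. Qed.

Lemma ps_eval_Im (a : fps) (x : C) :
  Im (ps_eval a x) = Series (fun k => a k * Im (x ^ k)%C).
Proof.
apply Series_ext; intros k; apply im_scal.
Qed.

Lemma CSeries_scal (c : R) (u : nat -> C) :
  CSeries (fun k => (RtoC c * u k)%C) = (RtoC c * CSeries u)%C.
Proof.
apply injective_projections; unfold CSeries; simpl.
- rewrite (Series_ext _ (fun k => c * Re (u k))), Series_scal_l; [ring|].
  intros k; apply re_scal_l.
- rewrite (Series_ext _ (fun k => c * Im (u k))), Series_scal_l; [ring|].
  intros k; apply im_scal.
Qed.

Lemma entire_abs_bounded (a : fps) (x : C) (u : nat -> R) :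
  entire a -> (forall k, Rabs (u k) <= Cmod (x ^ k)%C) ->
  ex_series (fun k => Rabs (a k * u k)).
Proof.
intros Ha Hu; apply (ex_series_le_abs _ (fun k => Rabs (a k) * Cmod x ^ k)).
- intros k; rewrite Rabs_Rabsolu, Rabs_mult; apply Rmult_le_compat_l; [apply Rabs_pos|].
  rewrite <- Cmod_pow; apply Hu.
- apply Ha, Cmod_ge_0.
Qed.

Lemma Im_le_Cmod (c : C) : Rabs (Im c) <= Cmod c.
Proof. eapply Rle_trans; [apply Rmax_r | apply (Rmax_Cmod c)]. Qed.

Lemma ex_series_ps_Re (a : fps) (x : C) : entire a ->
  ex_series (fun k => Rabs (a k * Re (x ^ k)%C)).
Proof. intros Ha; apply entire_abs_bounded with x; [exact Ha|]; intros k; apply re_le_Cmod. Qed.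

Lemma ex_series_ps_Im (a : fps) (x : C) : entire a ->
  ex_series (fun k => Rabs (a k * Im (x ^ k)%C)).
Proof. intros Ha; apply entire_abs_bounded with x; [exact Ha|]; intros k; apply Im_le_Cmod. Qed.

Lemma fps_mul_sum (a b : fps) (n : nat) :
  fps_mul a b n = sum_f_R0 (fun k => a k * b (n - k)%nat) n.
Proof.
revert a; induction n as [|n IH]; intros a; [reflexivity|].
simpl fps_mul; rewrite IH, (decomp_sum (fun k => a k * b (S n - k)%nat)) by lia.
simpl pred; f_equal.
Qed.

Lemma ps_eval_mul (a b : fps) (x : C) : entire a -> entire b ->
  ps_eval (fps_mul a b) x = (ps_eval a x * ps_eval b x)%C.
Proof.
intros Ha Hb.
(* [CSeries] works on real and imaginary parts, so the complex product is assembled from real Cauchy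
   products. The condition on [w] is the rule for the real part ([e = -1]) or the imaginary part
   ([e = 1]) of [x^(i+j)]. *)
assert (Hsum : forall u1 u2 v1 v2 : nat -> R,
  ex_series (fun k => Rabs (a k * u1 k)) -> ex_series (fun k => Rabs (b k * v1 k)) ->
  ex_series (fun k => Rabs (a k * u2 k)) -> ex_series (fun k => Rabs (b k * v2 k)) ->
  forall e w, (forall i j, w (i + j)%nat = u1 i * v1 j + e * (u2 i * v2 j)) ->
  Series (fun k => fps_mul a b k * w k) =
  Series (fun k => a k * u1 k) * Series (fun k => b k * v1 k) +
  e * (Series (fun k => a k * u2 k) * Series (fun k => b k * v2 k))).
{ intros u1 u2 v1 v2 A1 B1 A2 B2 e w Hw; apply is_series_unique.
  assert (S1 := is_series_mult _ _ _ _ (Series_correct _ (ex_series_Rabs _ A1))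
    (Series_correct _ (ex_series_Rabs _ B1)) A1 B1).
  assert (S2 := is_series_mult _ _ _ _ (Series_correct _ (ex_series_Rabs _ A2))
    (Series_correct _ (ex_series_Rabs _ B2)) A2 B2).
  apply (is_series_scal_l e) in S2.
  assert (S := is_series_plus _ _ _ _ S1 S2).
  eapply is_series_ext; [|exact S].
  intros n; eq_in_R; unfold plus, scal; simpl; unfold mult; simpl.
  rewrite fps_mul_sum, scal_sum, <- sum_plus, (Rmult_comm (sum_f_R0 _ n)), scal_sum.
  apply sum_eq; intros i Hi.
  replace (w n) with (w (i + (n - i))%nat) by (f_equal; lia).
  rewrite Hw; ring. }
assert (RA := ex_series_ps_Re a x Ha); assert (IA := ex_series_ps_Im a x Ha).
assert (RB := ex_series_ps_Re b x Hb); assert (IB := ex_series_ps_Im b x Hb).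
apply injective_projections.
- change (Re (ps_eval (fps_mul a b) x) = Re (ps_eval a x * ps_eval b x)%C).
  rewrite re_mult, !ps_eval_Re, !ps_eval_Im.
  rewrite (Hsum _ _ _ _ RA RB IA IB (-1)); [ring|].
  intros i j; rewrite Cpow_add_r, re_mult; ring.
- change (Im (ps_eval (fps_mul a b) x) = Im (ps_eval a x * ps_eval b x)%C).
  rewrite im_mult, !ps_eval_Re, !ps_eval_Im.
  rewrite (Hsum _ _ _ _ RA IB IA RB 1); [ring|].
  intros i j; rewrite Cpow_add_r, im_mult; ring.
Qed.

Lemma entire_mul (a b : fps) : entire a -> entire b -> entire (fps_mul a b).
Proof.
intros Ha Hb r Hr.
assert (Habs : forall c : fps, entire c -> ex_series (fun k => Rabs (Rabs (c k) * r ^ k))).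
{ intros c Hc; apply (ex_series_ext (fun k => Rabs (c k) * r ^ k)); [|now apply Hc].
  intros k; symmetry; apply Rabs_pos_eq.
  apply Rmult_le_pos; [apply Rabs_pos | now apply pow_le]. }
apply (ex_series_le_abs _ (fun n => sum_f_R0
  (fun k => Rabs (a k) * r ^ k * (Rabs (b (n - k)%nat) * r ^ (n - k))) n)).
- intros n; rewrite fps_mul_sum, Rabs_mult, Rabs_Rabsolu.
  rewrite (Rabs_pos_eq (r ^ n)) by now apply pow_le.
  apply Rle_trans with
    (sum_f_R0 (fun k => Rabs (a k * b (n - k)%nat)) n * r ^ n).
  + apply Rmult_le_compat_r; [now apply pow_le | apply Rsum_abs].
  + rewrite Rmult_comm, scal_sum; right; apply sum_eq; intros i Hi.
    replace (r ^ n) with (r ^ (i + (n - i))) by (f_equal; lia).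
    rewrite pow_add, Rabs_mult; ring.
- eexists; apply (is_series_mult (fun k => Rabs (a k) * r ^ k) (fun k => Rabs (b k) * r ^ k)).
  + apply Series_correct, Ha, Hr.
  + apply Series_correct, Hb, Hr.
  + now apply Habs.
  + now apply Habs.
Qed.

Lemma entire_scal (c : R) (a : fps) : entire a -> entire (fun k => c * a k).
Proof.
intros Ha r Hr; apply (ex_series_ext (fun k => Rabs c * (Rabs (a k) * r ^ k))).
- intros k; eq_in_R; rewrite Rabs_mult; ring.
- apply (ex_series_scal_l (Rabs c) (fun k => Rabs (a k) * r ^ k)); now apply Ha.
Qed.

Lemma entire_shift (a : fps) : entire a -> entire (fps_mul fps_X a).
Proof.
intros Ha r Hr; apply ex_series_incr_1.
apply (ex_series_ext (fun k => r * (Rabs (a k) * r ^ k))).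
- intros k; eq_in_R; rewrite fps_mul_Xl; simpl; ring.
- apply (ex_series_scal_l r (fun k => Rabs (a k) * r ^ k)); now apply Ha.
Qed.

Lemma ps_eval_lin (c d : R) (a b : fps) (x : C) : entire a -> entire b ->
  ps_eval (fun k => c * a k + d * b k) x = (RtoC c * ps_eval a x + RtoC d * ps_eval b x)%C.
Proof.
intros Ha Hb.
assert (Hs : forall u : nat -> R,
  ex_series (fun k => Rabs (a k * u k)) -> ex_series (fun k => Rabs (b k * u k)) ->
  Series (fun k => (c * a k + d * b k) * u k) =
  c * Series (fun k => a k * u k) + d * Series (fun k => b k * u k)).
{ intros u Hau Hbu; apply ex_series_Rabs in Hau; apply ex_series_Rabs in Hbu.
  rewrite <- !Series_scal_l, <- Series_plus.
  - apply Series_ext; intros k; ring.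
  - apply (ex_series_scal_l c (fun k => a k * u k)); exact Hau.
  - apply (ex_series_scal_l d (fun k => b k * u k)); exact Hbu. }
assert (RA := ex_series_ps_Re a x Ha); assert (IA := ex_series_ps_Im a x Ha).
assert (RB := ex_series_ps_Re b x Hb); assert (IB := ex_series_ps_Im b x Hb).
apply injective_projections.
- change (Re (ps_eval (fun k => c * a k + d * b k) x) =
    Re (RtoC c * ps_eval a x)%C + Re (RtoC d * ps_eval b x)%C).
  rewrite !re_scal_l, !ps_eval_Re; now apply Hs.
- change (Im (ps_eval (fun k => c * a k + d * b k) x) =
    Im (RtoC c * ps_eval a x)%C + Im (RtoC d * ps_eval b x)%C).
  rewrite !im_scal, !ps_eval_Im; now apply Hs.
Qed.

Lemma ps_eval_X (x : C) : ps_eval fps_X x = x.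
Proof.
assert (Hs : forall u : nat -> R, Series (fun k => fps_X k * u k) = u 1%nat).
{ intros u.
  assert (H0 : forall k, fps_X (S (S k)) * u (S (S k)) = 0) by (intros k; simpl; ring).
  assert (E : ex_series (fun k => fps_X k * u k)).
  { do 2 apply ex_series_incr_1; apply (ex_series_ext (fun _ => 0)).
    - intros k; eq_in_R; now rewrite H0.
    - apply (ex_series_le_abs _ (fun k => 0 / ((INR k + 1) * (INR k + 2))));
        [|apply ex_series_telescope].
      intros k; rewrite Rabs_R0; right; unfold Rdiv; ring. }
  rewrite Series_incr_1, Series_incr_1; trivial.
  - rewrite (Series_ext _ (fun k => 0 * u k)), Series_scal_l; [simpl; ring|].
    intros k; simpl; ring.
  - now apply (ex_series_incr_1 (fun k => fps_X k * u k)). }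
apply injective_projections.
- change (Re (ps_eval fps_X x) = Re x); rewrite ps_eval_Re, Hs, Cpow_1_r; reflexivity.
- change (Im (ps_eval fps_X x) = Im x); rewrite ps_eval_Im, Hs, Cpow_1_r; reflexivity.
Qed.

Lemma entire_X : entire fps_X.
Proof.
apply (entire_rec _ 1 1); [lra|]; intros [|k] Hk; [lia|].
change (fps_X (S (S k))) with 0; rewrite Rabs_R0.
generalize (Rabs_pos (fps_X (S k))); lra.
Qed.

Lemma bessel_coef_S (c : R) (k : nat) : (forall n, c + 1 + INR n <> 0) ->
  bessel_coef c (S k) = bessel_coef c k / ((c + 1 + INR k) * (INR k + 1)).
Proof.
intros Hc; unfold bessel_coef; rewrite hyp_coef_S by (intros d m [<-|[]]; apply Hc).
assert (INR k + 1 <> 0) by (generalize (pos_INR k); lra).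
assert (H1 := Hc k); unfold shift_prod; simpl; now field.
Qed.

Lemma entire_bessel_coef (c : R) : (forall n, c + 1 + INR n <> 0) ->
  entire (bessel_coef c).
Proof.
intros Hc; destruct (INR_unbounded (- c)) as [N HN].
apply (entire_rec _ 1 N); [lra|]; intros k Hk.
apply le_INR in Hk; assert (Hk0 := pos_INR k).
rewrite bessel_coef_S by assumption.
unfold Rdiv; rewrite Rabs_mult, Rabs_inv, (Rabs_pos_eq (_ * _)) by nra.
rewrite Rinv_mult, Rmult_assoc, Rmult_assoc, Rinv_l, Rmult_1_r, Rmult_comm by lra.
apply Rmult_le_compat_r; [apply Rabs_pos|].
rewrite <- Rinv_1; apply Rinv_le_contravar; lra.
Qed.

Lemma entire_hyp23 (nu : R) : 0 < nu -> entire (hyp23 nu).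
Proof.
intros Hnu; apply (entire_rec _ 4 0); [lra|]; intros k _.
assert (Hk := pos_INR k); rewrite hyp23_S, Rabs_mult by assumption.
rewrite Rmult_assoc, Rmult_comm; apply Rmult_le_compat_r; [apply Rabs_pos|].
rewrite Rabs_pos_eq.
- replace (4 * (nu + INR k) * (nu + INR k + 1 / 2) /
   ((nu + 1 + INR k) * (nu + 1 + INR k) * (2 * nu + 1 + INR k) * (INR k + 1)) * (INR k + 1))
  with (4 * ((nu + INR k) / (nu + 1 + INR k)) * ((nu + INR k + 1 / 2) / (nu + 1 + INR k))
        * / (2 * nu + 1 + INR k)) by (field; lra).
  assert (H1 : 0 <= (nu + INR k) / (nu + 1 + INR k) <= 1).
  { split; [apply Rdiv_le_0_compat; lra|]; apply Rle_div_l; lra. }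
  assert (H2 : 0 <= (nu + INR k + 1 / 2) / (nu + 1 + INR k) <= 1).
  { split; [apply Rdiv_le_0_compat; lra|]; apply Rle_div_l; lra. }
  assert (H3 : 0 <= / (2 * nu + 1 + INR k) <= 1).
  { split; [left; apply Rinv_0_lt_compat; lra|].
    rewrite <- Rinv_1; apply Rinv_le_contravar; lra. }
  revert H1 H2 H3; generalize ((nu + INR k) / (nu + 1 + INR k))
    ((nu + INR k + 1 / 2) / (nu + 1 + INR k)) (/ (2 * nu + 1 + INR k)).
  intros u v w Hu Hv Hw.
  assert (0 <= u * v <= 1) by nra; nra.
- apply Rdiv_le_0_compat; [repeat apply Rmult_le_pos; lra|].
  repeat apply Rmult_lt_0_compat; lra.
Qed.

Lemma entire_hyp34 (nu : R) : 0 < nu -> (forall n : Z, nu <> IZR n) -> entire (hyp34 nu).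
Proof.
(* For [k >= N > nu] the factor [2 - nu + k] exceeds 2, so each quotient in the factorization below
   lies between 0 and 1. *)
intros Hnu HZ; destruct (INR_unbounded nu) as [N HN].
apply (entire_rec _ 4 N); [lra|]; intros k Hkn; apply le_INR in Hkn.
assert (Hk := pos_INR k); rewrite hyp34_S, Rabs_mult by assumption.
rewrite Rmult_assoc, Rmult_comm; apply Rmult_le_compat_r; [apply Rabs_pos|].
rewrite Rabs_pos_eq.
- replace (4 * (INR k + 1) * (INR k + 3 / 2) /
   ((INR k + 2) * (INR k + 2) * (2 - nu + INR k) * (2 + nu + INR k)) * (INR k + 1))
  with (4 * ((INR k + 1) / (INR k + 2) * ((INR k + 1) / (INR k + 2)))
        * ((INR k + 3 / 2) / (2 + nu + INR k)) * / (2 - nu + INR k)) by (field; lra).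
  assert (H1 : 0 <= (INR k + 1) / (INR k + 2) <= 1).
  { split; [apply Rdiv_le_0_compat; lra|]; apply Rle_div_l; lra. }
  assert (H2 : 0 <= (INR k + 3 / 2) / (2 + nu + INR k) <= 1).
  { split; [apply Rdiv_le_0_compat; lra|]; apply Rle_div_l; lra. }
  assert (H3 : 0 <= / (2 - nu + INR k) <= 1).
  { split; [left; apply Rinv_0_lt_compat; lra|].
    rewrite <- Rinv_1; apply Rinv_le_contravar; lra. }
  revert H1 H2 H3; generalize ((INR k + 1) / (INR k + 2))
    ((INR k + 3 / 2) / (2 + nu + INR k)) (/ (2 - nu + INR k)).
  intros u v w Hu Hv Hw.
  assert (0 <= u * u <= 1) by nra.
  assert (0 <= u * u * v <= 1) by nra; nra.
- apply Rdiv_le_0_compat; [repeat apply Rmult_le_pos; lra|].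
  repeat apply Rmult_lt_0_compat; lra.
Qed.

(** * Differentiation with respect to the order *)

Lemma rpoch_ge1 (y : R) (k : nat) : 1 <= y -> 1 <= rpoch y k.
Proof.
intros Hy; induction k as [|k IH]; simpl; [lra|].
generalize (pos_INR k); nra.
Qed.

Lemma inv_le1 (y : R) : 1 <= y -> 0 < / y <= 1.
Proof.
intros Hy; split; [apply Rinv_0_lt_compat; lra|].
rewrite <- Rinv_1; apply Rinv_le_contravar; lra.
Qed.

Lemma shifted_harmonic_bound (y : R) (k : nat) : 1 <= y ->
  0 <= shifted_harmonic y k <= INR k.
Proof.
intros Hy; induction k as [|k IH]; simpl shifted_harmonic; [simpl; lra|].
rewrite S_INR; generalize (inv_le1 (y + INR k)) (pos_INR k); lra.
Qed.

(** For arguments at least 1 each factor [1/(y+j)] is at most 1 and 1-Lipschitz, so a product of [k]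
    of them is [k]-Lipschitz. *)
Lemma inv_rpoch_lipschitz (y h : R) (k : nat) : 1 <= y -> 1 <= y + h ->
  Rabs (/ rpoch (y + h) k - / rpoch y k) <= INR k * Rabs h.
Proof.
intros Hy Hyh; induction k as [|k IH].
- simpl; rewrite Rminus_diag, Rabs_R0; lra.
- simpl rpoch; rewrite S_INR, !Rinv_mult; assert (Hk := pos_INR k).
  assert (Hp := inv_le1 _ (rpoch_ge1 y k Hy)).
  assert (Hq := inv_le1 (y + INR k) ltac:(lra)).
  assert (Hq' := inv_le1 (y + h + INR k) ltac:(lra)).
  replace (/ rpoch (y + h) k * / (y + h + INR k) - / rpoch y k * / (y + INR k)) with
    ((/ rpoch (y + h) k - / rpoch y k) * / (y + h + INR k)
     + / rpoch y k * (- (h * (/ (y + INR k) * / (y + h + INR k))))).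
  2: { replace (- (h * (/ (y + INR k) * / (y + h + INR k))))
         with (/ (y + h + INR k) - / (y + INR k)) by (field; lra); ring. }
  eapply Rle_trans; [apply Rabs_triang|].
  rewrite !Rabs_mult, Rabs_Ropp, !Rabs_mult.
  rewrite (Rabs_pos_eq (/ (y + h + INR k))), (Rabs_pos_eq (/ (y + INR k))),
    (Rabs_pos_eq (/ rpoch y k)) by lra.
  assert (Hh := Rabs_pos h); assert (Hd := Rabs_pos (/ rpoch (y + h) k - / rpoch y k)).
  revert Hp Hq Hq' IH Hh Hd.
  generalize (/ rpoch y k) (/ (y + INR k)) (/ (y + h + INR k)) (Rabs h)
    (Rabs (/ rpoch (y + h) k - / rpoch y k)); intros p q q' H D Hp Hq Hq' IH Hh Hd.
  assert (D * q' <= D) by nra.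
  assert (Hqq : 0 <= q * q' <= 1) by (split; nra).
  assert (HH : 0 <= H * (q * q') <= H) by (revert Hqq; generalize (q * q'); intros; split; nra).
  assert (p * (H * (q * q')) <= H) by (revert HH; generalize (H * (q * q')); intros; nra).
  lra.
Qed.

(** Adding one factor increases the remainder by at most [|h|] times the Lipschitz bound
    [(k+1) |h|], and [k^2 + (k+1) <= (k+1)^2]. *)
Lemma inv_rpoch_second_order (y h : R) (k : nat) : 1 <= y -> 1 <= y + h ->
  Rabs (/ rpoch (y + h) k - / rpoch y k + h * (shifted_harmonic y k * / rpoch y k))
  <= INR k ^ 2 * (h * h).
Proof.
intros Hy Hyh; induction k as [|k IH].
- simpl; replace (/ 1 - / 1 + h * (0 * / 1)) with 0 by ring; rewrite Rabs_R0; lra.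
- simpl rpoch; simpl shifted_harmonic; rewrite S_INR, !Rinv_mult; assert (Hk := pos_INR k).
  assert (Hp := inv_le1 _ (rpoch_ge1 y k Hy)).
  assert (Hq := inv_le1 (y + INR k) ltac:(lra)).
  assert (Hq' := inv_le1 (y + h + INR k) ltac:(lra)).
  assert (HL := inv_rpoch_lipschitz y h (S k) Hy Hyh).
  simpl rpoch in HL; rewrite S_INR, !Rinv_mult in HL.
  set (d := / rpoch (y + h) k * / (y + h + INR k) - / rpoch y k * / (y + INR k)) in HL |- *.
  replace (d + h * ((shifted_harmonic y k + / (y + INR k)) * (/ rpoch y k * / (y + INR k))))
    with ((/ rpoch (y + h) k - / rpoch y k + h * (shifted_harmonic y k * / rpoch y k)) * / (y + INR k)
          + - (h * (/ (y + INR k) * d))).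
  2: { unfold d.
       assert (rpoch y k <> 0) by (generalize (rpoch_ge1 y k Hy); lra).
       assert (rpoch (y + h) k <> 0) by (generalize (rpoch_ge1 (y + h) k Hyh); lra).
       field; repeat split; first [assumption | lra]. }
  eapply Rle_trans; [apply Rabs_triang|].
  rewrite Rabs_mult, Rabs_Ropp, !(Rabs_mult h), !(Rabs_mult (/ (y + INR k))).
  rewrite (Rabs_pos_eq (/ (y + INR k))) by lra.
  assert (Hh := Rabs_pos h).
  assert (Hd := Rabs_pos d).
  replace (h * h) with (Rabs h * Rabs h) in *
    by (rewrite <- Rabs_mult; apply Rabs_pos_eq; nra).
  match goal with |- Rabs ?e * _ + _ <= _ => assert (He := Rabs_pos e); revert He IH;
    generalize (Rabs e) end.
  intros e He IH.
  revert Hq Hh Hd HL IH; generalize (Rabs h) (Rabs d) (/ (y + INR k)); intros H D q Hq Hh Hd HL IH.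
  assert (e * q <= e) by nra.
  assert (0 <= q * D <= D) by nra.
  assert (H * (q * D) <= H * ((INR k + 1) * H)) by (apply Rmult_le_compat_l; lra).
  assert (0 <= H * H) by nra.
  assert (0 <= INR k * (H * H)) by (apply Rmult_le_pos; lra).
  replace ((INR k + 1) ^ 2 * (H * H)) with (INR k ^ 2 * (H * H) + 2 * (INR k * (H * H)) + H * H) by ring.
  lra.
Qed.

Lemma bessel_coef_eq (c : R) (k : nat) :
  bessel_coef c k = / INR (fact k) * / rpoch (c + 1) k.
Proof.
unfold bessel_coef, hyp_coef, rpoch_prod; simpl.
unfold Rdiv; rewrite !Rmult_1_r, Rmult_1_l; apply Rmult_comm.
Qed.

(** Minus the derivative of [bessel_coef c k] with respect to [c]. *)
Definition bessel_dcoef (c : R) : fps :=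
  fun k => bessel_coef c k * shifted_harmonic (c + 1) k.

(** This majorant serves both the second-order remainders in the order and the coefficients
    [bessel_dcoef]. The constant 4 bounds [((k+1)/k)^2] for [k >= 1]. *)
Lemma entire_square_fact : entire (fun k => INR k ^ 2 * / INR (fact k)).
Proof.
apply (entire_rec _ 4 1); [lra|]; intros k Hk; apply le_INR in Hk; simpl (INR 1) in Hk.
assert (Hf := INR_fact_lt_0 k); assert (Hif := Rinv_0_lt_compat _ Hf).
rewrite fact_simpl, mult_INR, S_INR.
rewrite !Rabs_pos_eq.
- replace ((INR k + 1) ^ 2 * / ((INR k + 1) * INR (fact k)) * (INR k + 1))
    with ((INR k + 1) ^ 2 * / INR (fact k)) by (field; lra).
  rewrite <- Rmult_assoc; apply Rmult_le_compat_r; nra.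
- apply Rmult_le_pos; [nra | lra].
- apply Rmult_le_pos; [nra|]; left; apply Rinv_0_lt_compat; nra.
Qed.

Lemma bessel_dcoef_le (c : R) (k : nat) : 0 <= c ->
  Rabs (bessel_dcoef c k) <= Rabs (INR k ^ 2 * / INR (fact k)).
Proof.
intros Hc; unfold bessel_dcoef; rewrite bessel_coef_eq.
assert (Hp := inv_le1 _ (rpoch_ge1 (c + 1) k ltac:(lra))).
assert (Hh := shifted_harmonic_bound (c + 1) k ltac:(lra)).
assert (Hif := Rinv_0_lt_compat _ (INR_fact_lt_0 k)).
assert (Hk : INR k <= INR k ^ 2).
{ destruct k as [|k]; [simpl; lra|]; rewrite S_INR; generalize (pos_INR k); nra. }
rewrite !Rabs_pos_eq.
- rewrite Rmult_assoc, (Rmult_comm (INR k ^ 2)); apply Rmult_le_compat_l; [lra|].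
  nra.
- apply Rmult_le_pos; [nra | lra].
- repeat apply Rmult_le_pos; lra.
Qed.

Lemma entire_bessel_dcoef (c : R) : 0 <= c -> entire (bessel_dcoef c).
Proof.
intros Hc; apply (entire_le _ _ (fun k => bessel_dcoef_le c k Hc)), entire_square_fact.
Qed.

(** The sequence [u] stands for the real or the imaginary parts of the powers of [x]. *)
Lemma bessel_coef_series_deriv (nu : R) (x : C) (u : nat -> R) : 0 < nu ->
  (forall k, Rabs (u k) <= Cmod (x ^ k)%C) ->
  is_derive (fun mu => Series (fun k => bessel_coef mu k * u k)) nu
    (- Series (fun k => bessel_dcoef nu k * u k)).
Proof.
intros Hnu Hu.
replace (- Series (fun k => bessel_dcoef nu k * u k))
  with (Series (fun k => - 1 * (bessel_dcoef nu k * u k)))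
  by (rewrite Series_scal_l; ring).
(* The radius [nu] keeps [nu + h] positive, hence [nu + h + 1 >= 1], as the bounds on [rpoch]
   require. *)
apply (is_derive_Series (fun k mu => bessel_coef mu k * u k) _
  (fun k => Rabs (INR k ^ 2 * / INR (fact k) * u k)) nu nu Hnu).
- intros k h Hh; apply Rabs_def2 in Hh.
  assert (H := inv_rpoch_second_order (nu + 1) h k ltac:(lra) ltac:(lra)).
  replace (nu + 1 + h) with (nu + h + 1) in H by ring.
  unfold bessel_dcoef; rewrite !bessel_coef_eq.
  assert (Hif := Rinv_0_lt_compat _ (INR_fact_lt_0 k)).
  match goal with |- Rabs ?e <= _ => replace e with
    (/ INR (fact k) * u k * (/ rpoch (nu + h + 1) k - / rpoch (nu + 1) k
      + h * (shifted_harmonic (nu + 1) k * / rpoch (nu + 1) k))) by ring end.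
  rewrite !Rabs_mult, (Rabs_pos_eq (INR k ^ 2)) by nra.
  rewrite (Rabs_pos_eq (/ INR (fact k))) by lra.
  replace (INR k ^ 2 * / INR (fact k) * Rabs (u k) * (h * h)) with
    (/ INR (fact k) * Rabs (u k) * (INR k ^ 2 * (h * h))) by ring.
  apply Rmult_le_compat_l; [|exact H].
  apply Rmult_le_pos; [lra | apply Rabs_pos].
- apply (entire_abs_bounded (fun k => INR k ^ 2 * / INR (fact k)) x u); [|exact Hu].
  apply entire_square_fact.
- apply (ex_series_scal_l (-1) (fun k => bessel_dcoef nu k * u k)), ex_series_Rabs.
  apply (entire_abs_bounded _ x u); [|exact Hu]; apply entire_bessel_dcoef; lra.
- intros h Hh; apply Rabs_def2 in Hh; apply ex_series_Rabs.
  apply (entire_abs_bounded _ x u); [|exact Hu]; apply entire_bessel_coef.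
  intros n; generalize (pos_INR n); lra.
Qed.

(** Componentwise differentiation reduces the product rule and the derivative of a complex power to
    real computations; [is_Cderive_correct] returns to the derivative in the normed module. *)
Definition is_Cderive (f : R -> C) (x : R) (l : C) : Prop :=
  is_derive (fun t => Re (f t)) x (Re l) /\ is_derive (fun t => Im (f t)) x (Im l).

Lemma is_Cderive_correct (f : R -> C) (x : R) (l : C) :
  is_Cderive f x l -> @is_derive R_AbsRing C_R_NormedModule f x l.
Proof.
intros [Hr Hi].
apply (filterdiff_ext (fun t => (Re (f t), Im (f t)))).
{ intros t; now destruct (f t). }
apply (filterdiff_ext_lin (U := AbsRing_NormedModule R_AbsRing) (V := C_R_NormedModule)
  _ (fun y : R => (Rmult y (Re l), Rmult y (Im l)))).
- apply (filterdiff_comp'_2 (K := R_AbsRing) (T := AbsRing_NormedModule R_AbsRing)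
    (U := R_NormedModule) (V := R_NormedModule) (W := C_R_NormedModule)
    (fun t => Re (f t)) (fun t => Im (f t)) (fun a b => (a, b)) x
    (fun y => Rmult y (Re l)) (fun y => Rmult y (Im l)) (fun a b => (a, b)) Hr Hi).
  (* Pairing the two components is the identity map, hence its own differential. *)
  apply (filterdiff_ext (fun t => t)); [now intros []|].
  apply (filterdiff_ext_lin _ (fun t => t)); [|now intros []].
  apply filterdiff_id.
- intros y; now destruct l.
Qed.

Lemma is_Cderive_mul (f g : R -> C) (x : R) (l m : C) :
  is_Cderive f x l -> is_Cderive g x m ->
  is_Cderive (fun t => (f t * g t)%C) x (l * g x + f x * m)%C.
Proof.
intros [Fr Fi] [Gr Gi].
assert (Hm : forall (u v : R -> R) du dv, is_derive u x du -> is_derive v x dv ->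
  is_derive (fun t => u t * v t) x (du * v x + u x * dv)).
{ intros u v du dv Hu Hv; apply (is_derive_mult u v); trivial; intros; apply Rmult_comm. }
split.
- apply (is_derive_ext (fun t => Re (f t) * Re (g t) - Im (f t) * Im (g t))).
  { intros t; symmetry; apply re_mult. }
  replace (Re (l * g x + f x * m)%C) with
    ((Re l * Re (g x) + Re (f x) * Re m) - (Im l * Im (g x) + Im (f x) * Im m)).
  + apply (is_derive_minus (V := R_NormedModule)); now apply Hm.
  + destruct l, m, (f x), (g x); unfold Re, Im; simpl; ring.
- apply (is_derive_ext (fun t => Re (f t) * Im (g t) + Im (f t) * Re (g t))).
  { intros t; symmetry; apply im_mult. }
  replace (Im (l * g x + f x * m)%C) with
    ((Re l * Im (g x) + Re (f x) * Im m) + (Im l * Re (g x) + Im (f x) * Re m)).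
  + apply (is_derive_plus (V := R_NormedModule)); now apply Hm.
  + destruct l, m, (f x), (g x); unfold Re, Im; simpl; ring.
Qed.

Lemma is_Cderive_RtoC (f : R -> R) (x l : R) :
  is_derive f x l -> is_Cderive (fun t => RtoC (f t)) x (RtoC l).
Proof.
intros H; split; [exact H|].
apply (is_derive_const (V := R_NormedModule) 0).
Qed.

Lemma is_Cderive_Cpower (w : C) (x : R) :
  is_Cderive (fun t => Cpower w (RtoC t)) x (Cpower w (RtoC x) * Clog w)%C.
Proof.
unfold Cpower, Cexp; destruct (Clog w) as [a b]; split.
- apply (is_derive_ext (fun t => exp (t * a) * cos (t * b))).
  + intros t; unfold Re, Im; simpl.
    replace (t * a - 0 * b) with (t * a) by ring.
    replace (t * b + 0 * a) with (t * b) by ring; ring.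
  + unfold Re, Im; simpl.
    replace (x * a - 0 * b) with (x * a) by ring; replace (x * b + 0 * a) with (x * b) by ring.
    auto_derive; trivial; ring.
- apply (is_derive_ext (fun t => exp (t * a) * sin (t * b))).
  + intros t; unfold Re, Im; simpl.
    replace (t * a - 0 * b) with (t * a) by ring.
    replace (t * b + 0 * a) with (t * b) by ring; ring.
  + unfold Re, Im; simpl.
    replace (x * a - 0 * b) with (x * a) by ring; replace (x * b + 0 * a) with (x * b) by ring.
    auto_derive; trivial; ring.
Qed.

Lemma is_Cderive_bessel_series (nu : R) (x : C) : 0 < nu ->
  is_Cderive (fun mu => ps_eval (bessel_coef mu) x) nu (- ps_eval (bessel_dcoef nu) x)%C.
Proof.
intros Hnu; split.
- apply (is_derive_ext (fun mu => Series (fun k => bessel_coef mu k * Re (x ^ k)%C))).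
  { intros t; symmetry; apply ps_eval_Re. }
  change (Re (- ps_eval (bessel_dcoef nu) x)%C) with (- Re (ps_eval (bessel_dcoef nu) x)).
  rewrite ps_eval_Re; apply (bessel_coef_series_deriv nu x); [exact Hnu|].
  intros k; apply re_le_Cmod.
- apply (is_derive_ext (fun mu => Series (fun k => bessel_coef mu k * Im (x ^ k)%C))).
  { intros t; symmetry; apply ps_eval_Im. }
  change (Im (- ps_eval (bessel_dcoef nu) x)%C) with (- Im (ps_eval (bessel_dcoef nu) x)).
  rewrite ps_eval_Im; apply (bessel_coef_series_deriv nu x); [exact Hnu|].
  intros k; apply Im_le_Cmod.
Qed.

Lemma Gamma_shift (y : R) (k : nat) : (forall n, y + INR n <> 0) ->
  Gamma (y + INR k) = Gamma y * rpoch y k.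
Proof.
intros Hy; induction k as [|k IH].
- simpl; rewrite Rplus_0_r; ring.
- rewrite S_INR, <- Rplus_assoc, Gamma_rec, IH.
  + simpl; ring.
  + intros m; rewrite Rplus_assoc, <- plus_INR; apply Hy.
Qed.

Lemma neg_sq_pow (w : C) (k : nat) : ((- w ^ 2) ^ k = RtoC ((-1) ^ k)%R * w ^ (2 * k))%C.
Proof.
rewrite Cpow_mult_r, RtoC_pow, <- Cpow_mult_l; f_equal.
apply injective_projections; simpl; ring.
Qed.

Lemma BesselJ_ps (mu : R) (z : C) : (forall n, mu + 1 + INR n <> 0) ->
  BesselJ mu z =
  (Cpower (z / 2) (RtoC mu) * (RtoC (/ Gamma (mu + 1)) *
    ps_eval (bessel_coef mu) (- (z / 2) ^ 2)))%C.
Proof.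
intros Hmu; unfold BesselJ; f_equal; unfold ps_eval.
rewrite <- CSeries_scal; apply CSeries_ext; intros k.
replace (mu + INR k + 1) with (mu + 1 + INR k) by ring.
rewrite Gamma_shift by assumption.
rewrite neg_sq_pow, bessel_coef_eq.
unfold Rdiv; rewrite !Rinv_mult, !RtoC_mult; ring.
Qed.

(** * Principal values *)

Lemma RtoC_neq0 (x : R) : x <> 0 -> RtoC x <> 0%C.
Proof. intros Hx E; now apply Hx, RtoC_inj. Qed.

Lemma Cexp_plus (a b : C) : Cexp (a + b) = (Cexp a * Cexp b)%C.
Proof.
destruct a as [a1 a2], b as [b1 b2]; unfold Cexp, Re, Im; simpl.
apply injective_projections; simpl; rewrite exp_plus, ?cos_plus, ?sin_plus; ring.
Qed.

Lemma Cpower_plus (w a b : C) : Cpower w (a + b) = (Cpower w a * Cpower w b)%C.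
Proof.
unfold Cpower; rewrite <- Cexp_plus; f_equal; ring.
Qed.

Lemma Cmod_half (z : C) : Cmod (z / 2)%C = Cmod z / 2.
Proof.
rewrite Cmod_div by (apply RtoC_neq0; lra).
rewrite Cmod_R, Rabs_pos_eq; lra.
Qed.

(* False for [z < 0]: there both arguments equal [PI]. *)
Lemma Clog_2_div (z : C) : z <> 0%C -> Rabs (Carg z) < PI ->
  Clog (2 / z) = (- Clog (z / 2))%C.
Proof.
intros Hz Harg.
assert (Hm : 0 < Cmod z) by now apply Cmod_gt_0.
assert (Hz2 : Cmod (2 / z)%C = 2 / Cmod z).
{ rewrite Cmod_div by assumption; rewrite Cmod_R, Rabs_pos_eq; lra. }
assert (E1 : (z / 2)%C = (Re z / 2, Im z / 2)).
{ destruct z as [a b]; apply injective_projections; unfold Re, Im; simpl; field. }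
assert (Hm2 : Re z * Re z + Im z * Im z = Cmod z * Cmod z).
{ generalize (Cmod2_alt z); simpl; rewrite !Rmult_1_r; intros ->; reflexivity. }
assert (E2 : (2 / z)%C = (2 * Re z / (Cmod z * Cmod z), - (2 * Im z) / (Cmod z * Cmod z))).
{ rewrite <- Hm2; destruct z as [a b]; unfold Re, Im in *; simpl in *.
  assert (a * a + b * b <> 0) by nra.
  apply injective_projections; simpl; field; rewrite ?Rmult_1_r; lra. }
assert (HmR : Cmod z * Cmod z > 0) by nra.
unfold Clog, Copp; simpl; f_equal.
- rewrite Hz2, Cmod_half.
  replace (2 / Cmod z) with (/ (Cmod z / 2)) by (field; lra).
  apply ln_Rinv; lra.
- unfold Carg; rewrite Hz2, Cmod_half, E1, E2.
  unfold Carg in Harg; simpl.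
  replace (2 * Re z / (Cmod z * Cmod z) / (2 / Cmod z)) with (Re z / Cmod z) by (field; lra).
  replace (Re z / 2 / (Cmod z / 2)) with (Re z / Cmod z) by (field; lra).
  assert (Hs : - (2 * Im z) / (Cmod z * Cmod z) = - Im z * (2 / (Cmod z * Cmod z))) by (field; lra).
  assert (H2 : 0 < 2 / (Cmod z * Cmod z)) by (apply Rdiv_lt_0_compat; lra).
  rewrite Hs; revert H2; generalize (2 / (Cmod z * Cmod z)); intros c Hc.
  destruct (Rtotal_order (Im z) 0) as [H|[H|H]].
  + destruct (Rle_dec 0 (- Im z * c)); [|nra].
    destruct (Rle_dec 0 (Im z / 2)); [lra|ring].
  + rewrite H in *.
    destruct (Rle_dec 0 0); [|lra].
    destruct (Rle_dec 0 (- 0 * c)); [|nra].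
    destruct (Rle_dec 0 (0 / 2)); [|lra].
    (* On the real axis both arguments are the same [acos], so it must be 0. This holds for
       [Re z = Cmod z]; for [Re z = - Cmod z] the argument would be [PI], which [Harg] excludes. *)
    assert (Hr : Re z * Re z = Cmod z * Cmod z) by lra.
    assert (Hr' : (Re z - Cmod z) * (Re z + Cmod z) = 0) by lra.
    apply Rmult_integral in Hr'; destruct Hr' as [Hr'|Hr'].
    * replace (Re z / Cmod z) with 1; [rewrite acos_1; ring|].
      replace (Re z) with (Cmod z) by lra; field; lra.
    * exfalso; replace (Re z / Cmod z) with (Ropp 1) in Harg.
      -- generalize PI_RGT_0; intros; destruct (Rle_dec 0 0); [|lra].
         rewrite acos_opp, acos_1, Rabs_pos_eq in Harg; lra.
      -- replace (Re z) with (- Cmod z) by lra; field; lra.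
  + destruct (Rle_dec 0 (- Im z * c)); [nra|].
    destruct (Rle_dec 0 (Im z / 2)); [ring|lra].
Qed.

(** * Hypergeometric series as evaluated power series *)

Lemma pochhammer_RtoC (a : R) (k : nat) : pochhammer (RtoC a) k = RtoC (rpoch a k).
Proof.
induction k as [|k IH]; [reflexivity|].
simpl; rewrite IH, RtoC_mult, RtoC_plus; reflexivity.
Qed.

Lemma pochhammer_prod_RtoC (l : list R) (k : nat) :
  pochhammer_prod (map RtoC l) k = RtoC (rpoch_prod l k).
Proof.
unfold pochhammer_prod, rpoch_prod; induction l as [|a l IH]; [reflexivity|].
cbn [map fold_right]; rewrite IH, pochhammer_RtoC, RtoC_mult; reflexivity.
Qed.

Lemma hypergeom_ps (a b : list R) (x : C) :
  (forall c n, In c b -> c + INR n <> 0) ->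
  hypergeom (map RtoC a) (map RtoC b) (4 * x) =
  ps_eval (fun k => hyp_coef a b k * 4 ^ k) x.
Proof.
intros Hb; apply CSeries_ext; intros k.
rewrite !pochhammer_prod_RtoC; unfold hyp_coef.
assert (H1 := rpoch_prod_neq0 b k Hb); assert (H2 := INR_fact_neq_0 k).
rewrite RtoC_mult, !RtoC_div, Cpow_mult_l, RtoC_pow by assumption.
field; split; now apply RtoC_neq0.
Qed.

Lemma bessel_eval_identity (nu : R) (x : C) :
  0 < nu -> (forall n : Z, nu <> IZR n) ->
  (ps_eval (bessel_coef nu) x + 2 * RtoC nu * ps_eval (bessel_dcoef nu) x =
   ps_eval (bessel_coef (- nu)) x * ps_eval (hyp23 nu) x
   - 2 * RtoC nu * (ps_eval (bessel_coef nu) x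
       * (x * RtoC (/ (1 - nu ^ 2)) * ps_eval (hyp34 nu) x)))%C.
Proof.
intros Hnu HZ.
assert (H1 : forall n, nu + 1 + INR n <> 0) by (intros n; generalize (pos_INR n); lra).
assert (H2 : forall n, - nu + 1 + INR n <> 0).
{ intros m Hm; apply (nonint_opp_shift nu 1 m HZ); lra. }
assert (EA := entire_bessel_coef nu H1); assert (EB := entire_bessel_coef (- nu) H2).
assert (ED : entire (bessel_dcoef nu)) by (apply entire_bessel_dcoef; lra).
assert (EF := entire_hyp23 nu Hnu); assert (EG := entire_hyp34 nu Hnu HZ).
pose (g := fun k => / (1 - nu ^ 2) * hyp34 nu k).
assert (Eg : entire g) by now apply entire_scal.
assert (Hg : hyp34_shifted nu = fps_mul fps_X g).
{ unfold hyp34_shifted; rewrite <- fps_mulA; f_equal.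
  apply functional_extensionality; intros n; apply fps_mul_constl. }
assert (Hgx : ps_eval g x = (RtoC (/ (1 - nu ^ 2)) * ps_eval (hyp34 nu) x)%C).
{ unfold ps_eval; rewrite <- CSeries_scal; apply CSeries_ext; intros k.
  unfold g; rewrite RtoC_mult; ring. }
assert (EXg : entire (fps_mul fps_X g)) by now apply entire_shift.
assert (Hid := bessel_hyp_identity nu Hnu HZ); rewrite Hg in Hid.
assert (L : (fun k => 1 * bessel_coef nu k + 2 * nu * bessel_dcoef nu k) =
  (fun k => 1 * fps_mul (bessel_coef (- nu)) (hyp23 nu) k
     + - (2 * nu) * fps_mul (bessel_coef nu) (fps_mul fps_X g) k)).
{ apply functional_extensionality; intros k.
  generalize (f_equal (fun s => s k) Hid); unfold fps_sub.
  rewrite <- fps_mulA, !fps_mul_constl; unfold bessel_dcoef; lra. }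
apply (f_equal (fun s => ps_eval s x)) in L.
rewrite !ps_eval_lin, !ps_eval_mul, ps_eval_X, Hgx in L;
  try assumption; try now apply entire_mul.
2: apply entire_X.
rewrite RtoC_opp, RtoC_mult in L.
transitivity (RtoC 1 * ps_eval (bessel_coef nu) x + 2 * RtoC nu * ps_eval (bessel_dcoef nu) x)%C;
  [ring|].
rewrite L; ring.
Qed.

(** * The derivative of the Bessel function in its order *)

Open Scope C_scope.

Lemma BesselJ_derive (nu : R) (z : C) : (0 < nu)%R ->
  let x := - (z / 2) ^ 2 in
  @is_derive R_AbsRing C_R_NormedModule (fun mu : R => BesselJ mu z) nu
    (Cpower (z / 2) nu * RtoC (/ Gamma (nu + 1)) *
      ((Clog (z / 2) - RtoC (1 / nu) - digamma nu) * ps_eval (bessel_coef nu) x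
       - ps_eval (bessel_dcoef nu) x)).
Proof.
intros Hnu x.
assert (HG := Gamma_gt0 nu Hnu).
assert (Hrec : forall y, (0 < y)%R -> Gamma (y + 1) = (y * Gamma y)%R).
{ intros y Hy; apply Gamma_rec; intros m; generalize (pos_INR m); lra. }
(* Writing [Gamma (y + 1)] as [y * Gamma y] makes the logarithmic derivative appear as
   [1/nu + digamma nu], the form used in the theorem. *)
assert (HdG : is_derive (fun y => / (y * Gamma y))%R nu
  (- (1 / nu + digamma nu) * / Gamma (nu + 1))%R).
{ assert (HD := ex_derive_Gamma nu Hnu).
  unfold digamma; rewrite Hrec by assumption.
  auto_derive; [repeat split; trivial; apply Rgt_not_eq; nra|].
  change (fun x0 => Gamma x0) with Gamma; field; lra. }
apply (is_derive_ext_loc (fun mu : R => Cpower (z / 2) mu *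
  (RtoC (/ (mu * Gamma mu)) * ps_eval (bessel_coef mu) x))).
{ exists (mkposreal nu Hnu); intros y Hy.
  unfold ball in Hy; simpl in Hy; unfold AbsRing_ball, abs, minus, plus, opp in Hy; simpl in Hy.
  apply Rabs_def2 in Hy; symmetry; rewrite <- Hrec by lra; apply BesselJ_ps.
  intros n; generalize (pos_INR n); lra. }
apply is_Cderive_correct.
assert (HM := is_Cderive_mul _ _ _ _ _ (is_Cderive_Cpower (z / 2) nu)
  (is_Cderive_mul _ _ _ _ _ (is_Cderive_RtoC _ _ _ HdG) (is_Cderive_bessel_series nu x Hnu))).
cbv beta in HM.
match type of HM with is_Cderive _ _ ?l => match goal with |- is_Cderive _ _ ?m =>
  replace m with l; [exact HM|] end end.
rewrite <- Hrec, RtoC_mult, RtoC_opp, RtoC_plus by assumption; ring.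
Qed.

Theorem mainTheorem1 :
  forall (nu : R) (z : C),
    (0 < nu)%R ->
    (forall n : Z, nu <> IZR n) ->
    z <> 0 ->
    (Rabs (Carg z) < PI)%R ->
    @is_derive R_AbsRing C_R_NormedModule (fun mu : R => BesselJ mu z) nu
      (- (PI * BesselJ (- nu)%R z * RtoC (/ sin (PI * nu))%R
            / (2 * Gamma (nu + 1)%R ^ 2))
         * Cpower (z / 2) (2 * nu)
         * hypergeom [RtoC nu; nu + 1 / 2] [nu + 1; nu + 1; 2 * nu + 1] (- z ^ 2)
       - BesselJ nu z
         * (z ^ 2 / (4 * (1 - nu ^ 2))
              * hypergeom [RtoC 1; RtoC 1; 3 / 2]
                          [RtoC 2; RtoC 2; 2 - nu; 2 + nu] (- z ^ 2)
            + Clog (2 / z) + 1 / (2 * nu) + digamma nu)).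
Proof.
intros nu z Hnu HZ Hz Harg.
assert (H1 : forall n, (nu + 1 + INR n <> 0)%R) by (intros n; generalize (pos_INR n); lra).
assert (H2 : forall n, (- nu + 1 + INR n <> 0)%R).
{ intros m Hm; apply (nonint_opp_shift nu 1 m HZ); lra. }
assert (HD := BesselJ_derive nu z Hnu); cbv zeta in HD.
match type of HD with is_derive _ _ ?l => match goal with |- is_derive _ _ ?m =>
  replace m with l; [exact HD|] end end.
set (x := - (z / 2) ^ 2).
assert (Hx : - z ^ 2 = 4 * x) by (unfold x; field; apply RtoC_neq0; lra).
assert (HF : hypergeom [RtoC nu; nu + 1 / 2] [nu + 1; nu + 1; 2 * nu + 1] (- z ^ 2)
  = ps_eval (hyp23 nu) x).
{ rewrite Hx; unfold hyp23; rewrite <- hypergeom_ps.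
  - cbn [map]; rewrite !RtoC_plus, RtoC_div, RtoC_mult by lra; reflexivity.
  - intros d m Hd; generalize (pos_INR m); simpl in Hd.
    destruct Hd as [<-|[<-|[<-|[]]]]; lra. }
assert (HH : hypergeom [RtoC 1; RtoC 1; 3 / 2] [RtoC 2; RtoC 2; 2 - nu; 2 + nu] (- z ^ 2)
  = ps_eval (hyp34 nu) x).
{ rewrite Hx; unfold hyp34; rewrite <- hypergeom_ps.
  - cbn [map]; rewrite RtoC_plus, RtoC_minus, RtoC_div by lra; reflexivity.
  - intros d m Hd; generalize (pos_INR m); simpl in Hd.
    destruct Hd as [<-|[<-|[<-|[<-|[]]]]]; try lra.
    intros _; now apply nonint_opp_shift. }
rewrite HF, HH, Clog_2_div by assumption.
rewrite (BesselJ_ps nu z H1), (BesselJ_ps (- nu) z H2); fold x.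
assert (Hid := bessel_eval_identity nu x Hnu HZ).
assert (Hrefl := Gamma_reflection nu HZ).
assert (HG := Gamma_gt0 nu Hnu).
assert (Hrec : Gamma (nu + 1) = (nu * Gamma nu)%R).
{ apply Gamma_rec; intros m; generalize (pos_INR m); lra. }
assert (Hsin : sin (PI * nu) <> 0%R /\ Gamma (1 - nu) <> 0%R).
{ split; intros E; rewrite E in Hrefl; generalize PI_RGT_0; lra. }
destruct Hsin as [Hsin HG1].
replace (- nu + 1)%R with (1 - nu)%R by ring.
assert (HW : Cpower (z / 2) (RtoC (- nu)) * Cpower (z / 2) (2 * nu) = Cpower (z / 2) nu).
{ rewrite <- Cpower_plus; f_equal; rewrite RtoC_opp; ring. }
assert (Hnu2 : (1 - nu ^ 2 <> 0)%R).
{ replace (1 - nu ^ 2)%R with ((1 - nu) * (1 + nu))%R by ring.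
  generalize (HZ 1%Z); intros; apply Rmult_integral_contrapositive; lra. }
(* The reflection formula absorbs the cosecant and the factor [1 / Gamma (1 - nu)] of [J_(-nu)]. *)
assert (Hcst : RtoC PI * RtoC (/ sin (PI * nu)) * RtoC (/ Gamma (1 - nu)) = RtoC (Gamma nu)).
{ rewrite <- !RtoC_mult; f_equal.
  transitivity (Gamma nu * Gamma (1 - nu) * sin (PI * nu) * / sin (PI * nu) * / Gamma (1 - nu))%R.
  - now rewrite Hrefl.
  - now field. }
assert (Hnu0 : RtoC nu <> 0) by (apply RtoC_neq0; lra).
assert (HG0 : RtoC (Gamma nu) <> 0) by (apply RtoC_neq0; lra).
assert (Hnu2C : 1 - RtoC nu ^ 2 <> 0).
{ rewrite <- RtoC_pow, <- RtoC_minus; now apply RtoC_neq0. }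
assert (H20 : RtoC 2 <> 0) by (apply RtoC_neq0; lra).
assert (Hz2 : z ^ 2 = - (4 * x)) by (rewrite <- Hx; ring).
rewrite Hz2, Hrec, RtoC_inv, RtoC_div by nra.
rewrite RtoC_inv, RtoC_minus, RtoC_pow in Hid by assumption.
rewrite RtoC_mult.
(* Once the powers, series values and constants are variables, a rational identity remains, modulo
   these three relations. *)
revert HW Hcst Hid.
generalize (Cpower (z / 2) (RtoC (- nu))) (Cpower (z / 2) (2 * nu)) (Cpower (z / 2) nu).
generalize (ps_eval (bessel_coef nu) x) (ps_eval (bessel_dcoef nu) x)
  (ps_eval (bessel_coef (- nu)) x) (ps_eval (hyp23 nu) x) (ps_eval (hyp34 nu) x) (Clog (z / 2)).
generalize (RtoC PI) (RtoC (/ sin (PI * nu))) (RtoC (/ Gamma (1 - nu))).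
intros p s g1 E D B F G L Wm W2 W HW Hcst Hid.
(* The term [- E / (2 nu)], subtracted with [D], turns the [1/nu] coming from Gamma into the
   [1/(2 nu)] of the theorem. *)
assert (HDe : D = (B * F - 2 * nu * (E * (x * / (1 - nu ^ 2) * G)) - E) / (2 * nu)).
{ replace (B * F - 2 * nu * (E * (x * / (1 - nu ^ 2) * G))) with (E + 2 * nu * D) by exact Hid.
  field; assumption. }
rewrite HDe.
transitivity (- ((p * s * g1) * (Wm * W2) * B * F / (2 * (nu * Gamma nu) ^ 2))
  - W * (/ (nu * Gamma nu) * E) *
    (- (4 * x) / (4 * (1 - nu ^ 2)) * G + - L + 1 / (2 * nu) + digamma nu)).
- rewrite Hcst, HW; field; repeat split; assumption.
- field; repeat split; assumption.
Qed.
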